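(* Let $V=\sum_{m\in\mathbb Z}\mathbb C v_m$ be an indecomposable $\mathcal L$-module, with basis $\{v_m\}_{m\in\mathbb Z}$, such that $\mathcal L_m v_n\subset \mathbb C v_{m+n}$ for all $m,n\in\mathbb Z$. Then $V$ is isomorphic to one of the modules $\mathcal A_{a,b,c}$, $\mathcal A(a,c)$, $\mathcal B(a,c)$, $\mathcal U_d$, $\mathcal V_d$, $\tilde{\mathcal U}_d$, $\tilde{\mathcal V}_c$ (defined in the context) for appropriate $a,b,c,d\in\mathbb C$.
   Context: The twisted Heisenberg-Virasoro algebra $\mathcal L$ is the complex Lie algebra with basis $\{L(m),I(m),C_L,C_I,C_{LI}: m\in\mathbb Z\}$ and brackets, for $m,n\in\mathbb Z$, $$[L(m),L(n)]=(n-m)L(m+n)+\delta_{m+n,0}\tfrac1{12}(m^3-m)C_L,$$ $$[I(m),I(n)]=n\,\delta_{m+n,0}C_I,$$ $$[L(m),I(n)]=n\,I(m+n)+\delta_{m+n,0}(m^2-m)C_{LI},$$ with $C_L,C_I,C_{LI}$ central. It is $\mathbb Z$-graded, $\mathcal L=\bigoplus_{m\in\mathbb Z}\mathcal L_m$, where $\mathcal L_m=\mathrm{span}\{L(m),I(m)\}$ for $m\ne0$ and $\mathcal L_0=\mathrm{span}\{L(0),I(0),C_L,C_I,C_{LI}\}$. The following are $\mathcal L$-modules with basis $\{v_t\}_{t\in\mathbb Z}$, on which $C_L,C_I,C_{LI}$ act as $0$ (formulas for all $n,t\in\mathbb Z$ subject to the indicated conditions): (1) $\mathcal A_{a,b,c}$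 ($a,b,c\in\mathbb C$): $L(n)v_t=(a+t+bn)v_{n+t}$, $I(n)v_t=c\,v_{n+t}$. (2) $\mathcal A(a,d)$ ($a,d\in\mathbb C$): $L(n)v_t=(t+n)v_{n+t}$ if $t\ne0$, $L(n)v_0=n(n+a)v_n$; $I(n)v_t=0$ if $t\ne0$, $I(n)v_0=dn\,v_n$. (3) $\mathcal B(a,d)$ ($a,d\in\mathbb C$): $L(n)v_t=t\,v_{n+t}$ if $t\ne-n$, $L(n)v_{-n}=-n(n+a)v_0$; $I(n)v_t=0$ if $n+t\ne0$, $I(n)v_{-n}=dn\,v_0$. (4) $\mathcal U_d$ ($d\in\mathbb C$): $L(n)v_t=t\,v_{n+t}$; $I(n)v_t=0$ if $n+t\neq0$, $I(n)v_{-n}=nd\,v_0$. (5) $\mathcal V_d$ ($d\in\mathbb C$): $L(n)v_t=(t+n)v_{n+t}$; $I(n)v_t=0$ if $t\ne0$, $I(n)v_0=nd\,v_n$. (6) $\tilde{\mathcal U}_d$ ($d\in\mathbb C$, $d\neq0$): $L(n)v_t=t\,v_{n+t}$ if $n+t\ne0$, $L(n)v_{-n}=0$; $I(n)v_t=0$ if $n+t\ne0$, $I(n)v_{-n}=dn\,v_0$. (7) $\tilde{\mathcal V}_c$ ($c\in\mathbb C$, $c\ne0$): $L(n)v_t=t\,v_{n+t}$ if $n+t\ne0$, $L(n)v_{-n}=0$; $I(n)v_t=0$ if $t\ne0$ or $n=t=0$, $I(n)v_0=c\,v_n$ if $n\ne0$. *)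

(* Defs.v *)
From HB Require Import structures.
From mathcomp Require Import all_boot all_order all_algebra.
From mathcomp Require Import finmap.
From mathcomp.multinomials Require Import monalg.
From mathcomp Require Import complex reals.
From mathcomp Require Import ring zify.

Set Implicit Arguments.
Unset Strict Implicit.
Unset Printing Implicit Defensive.

Import GRing.Theory.
Local Open Scope ring_scope.

HB.mixin Record Lmodule_isLieAlgebra (F : fieldType) L of GRing.Lmodule F L := {
  lie_bracket : L -> L -> L;
  lie_bracket_linearl : forall y, linear (lie_bracket^~ y);
  lie_bracket_linearr : forall x, linear (lie_bracket x);
  lie_bracketxx : forall x, lie_bracket x x = 0;
  lie_jacobi : forall x y z,
    lie_bracket x (lie_bracket y z) + lie_bracket y (lie_bracket z x)
      + lie_bracket z (lie_bracket x y) = 0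
}.

#[short(type="lieAlgType")]
HB.structure Definition LieAlgebra (F : fieldType) :=
  {L of GRing.Lmodule F L & Lmodule_isLieAlgebra F L}.

Record lie_module (F : fieldType) (L : lieAlgType F) (V : lmodType F) :=
  LieModule {
    lie_act :> L -> V -> V;
    lie_act_linearl : forall v, linear (lie_act^~ v);
    lie_act_linearr : forall x, linear (lie_act x);
    lie_act_bracket : forall x y v,
      lie_act (lie_bracket x y) v
        = lie_act x (lie_act y v) - lie_act y (lie_act x v)
  }.

Definition lie_module_iso (F : fieldType) (L : lieAlgType F)
    (V W : lmodType F) (rho : lie_module L V) (sigma : lie_module L W) : Prop :=
  exists f : {linear V -> W},
    bijective f /\ forall x v, f (rho x v) = sigma x (f v).

Definition lie_submodule (F : fieldType) (L : lieAlgType F) (V : lmodType F)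
    (rho : lie_module L V) (U : V -> Prop) : Prop :=
  [/\ U 0,
      forall k u w, U u -> U w -> U (k *: u + w)
    & forall x u, U u -> U (rho x u)].

Definition indecomposable (F : fieldType) (L : lieAlgType F) (V : lmodType F)
    (rho : lie_module L V) : Prop :=
  (exists v : V, v <> 0) /\
  forall U W : V -> Prop,
    lie_submodule rho U -> lie_submodule rho W ->
    (forall v, exists u w, [/\ U u, W w & v = u + w]) ->
    (forall v, U v -> W v -> v = 0) ->
    (forall v, U v -> v = 0) \/ (forall v, W v -> v = 0).

(* [{malg F[K]}] is used only as the free F-vector space on K, with basis
   << k >> (coefficients x@_k, finite support [msupp x]); its multiplication
   plays no role. *)
HB.lock Definition lin_ext (F : fieldType) (K : choiceType) (V : lmodType F)
    (f : K -> V) (x : {malg F[K]}) : V :=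
  \sum_(k <- msupp x) x@_k *: f k.

Canonical lin_ext_unlockable := Unlockable lin_ext.unlock.

Definition is_basis (F : fieldType) (K : choiceType) (V : lmodType F)
    (v : K -> V) : Prop :=
  forall x : V, exists! c : {malg F[K]}, x = lin_ext v c.

Section LinExt.
Variables (F : fieldType) (K : choiceType).
Implicit Types (V W : lmodType F) (x : {malg F[K]}).

Lemma lin_extEw V (f : K -> V) x (d : {fset K}) : fsubset (msupp x) d ->
  lin_ext f x = \sum_(k <- d) x@_k *: f k.
Proof.
move=> le; rewrite unlock; apply: big_fset_incl le _ => k _ /mcoeff_outdom ->.
by rewrite scale0r.
Qed.

Lemma lin_ext_linear V (f : K -> V) : linear (lin_ext f).
Proof.
move=> c x y; pose d := fsetU (msupp x) (msupp y).
have dx : fsubset (msupp x) d by apply: fsubsetUl.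
have dy : fsubset (msupp y) d by apply: fsubsetUr.
have dz : fsubset (msupp (c *: x + y)) d.
  apply: fsubset_trans (msuppD_le _ _) _; rewrite fsubUset dy andbT.
  exact: fsubset_trans (msuppZ_le _ _) dx.
rewrite (lin_extEw f dx) (lin_extEw f dy) (lin_extEw f dz) scaler_sumr.
rewrite -big_split; apply: eq_bigr => k _ /=.
by rewrite mcoeffD mcoeffZ scalerDl scalerA.
Qed.

HB.instance Definition _ V (f : K -> V) :=
  GRing.isLinear.Build F {malg F[K]} V *:%R (lin_ext f) (lin_ext_linear f).

Lemma lin_extU V (f : K -> V) k : lin_ext f << k >> = f k.
Proof.
by rewrite unlock msuppU oner_eq0 big_seq_fset1 mcoeffUU scale1r.
Qed.

Lemma lin_extE x : x = lin_ext (fun k => << k >>) x.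
Proof.
rewrite unlock [LHS]monalgE; apply: eq_bigr => k _.
by apply/malgP => j; rewrite mcoeffZ !mcoeffU mulr_natr.
Qed.

Lemma malg_linear_eq V (f g : {malg F[K]} -> V) : linear f -> linear g ->
  (forall k, f << k >> = g << k >>) -> f =1 g.
Proof.
move=> fl gl fg x.
have fD := GRing.isLinear.Build F {malg F[K]} V *:%R f fl.
have gD := GRing.isLinear.Build F {malg F[K]} V *:%R g gl.
pose f' : {linear {malg F[K]} -> V} := HB.pack f fD.
pose g' : {linear {malg F[K]} -> V} := HB.pack g gD.
rewrite (lin_extE x) -[f _]/(f' _) -[g _]/(g' _) unlock !linear_sum.
by apply: eq_bigr => k _; rewrite !linearZ; congr (_ *: _); apply: fg.
Qed.

Lemma lin_ext_linearl V W (f : K -> V -> W) (v : V) (x : {malg F[K]}) c u :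
  (forall k, linear (f k)) ->
  lin_ext (fun k => f k (c *: u + v)) x
    = c *: lin_ext (f^~ u) x + lin_ext (f^~ v) x.
Proof.
move=> fl; rewrite unlock scaler_sumr -big_split; apply: eq_bigr => k _ /=.
by rewrite fl scalerDr !scalerA mulrC.
Qed.

End LinExt.

Inductive hv_gen := Lgen of int | Igen of int | CLgen | CIgen | CLIgen.

Definition hv_gen_encode (g : hv_gen) : int + int + option bool :=
  match g with
  | Lgen m => inl (inl m)
  | Igen m => inl (inr m)
  | CLgen => inr None
  | CIgen => inr (Some true)
  | CLIgen => inr (Some false)
  end.

Definition hv_gen_decode (s : int + int + option bool) : hv_gen :=
  match s with
  | inl (inl m) => Lgen m
  | inl (inr m) => Igen m
  | inr None => CLgen
  | inr (Some true) => CIgen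
  | inr (Some false) => CLIgen
  end.

Lemma hv_gen_encodeK : cancel hv_gen_encode hv_gen_decode.
Proof. by case. Qed.

HB.instance Definition _ := Equality.copy hv_gen (can_type hv_gen_encodeK).
HB.instance Definition _ := Choice.copy hv_gen (can_type hv_gen_encodeK).

Definition heisvir (F : numFieldType) : Type := {malg F[hv_gen]}.

HB.instance Definition _ (F : numFieldType) :=
  GRing.Lmodule.copy (heisvir F) {malg F[hv_gen]}.

Definition hv_gen_bracket (F : numFieldType) (g h : hv_gen) : heisvir F :=
  match g, h with
  | Lgen m, Lgen n =>
      (n - m)%:~R *: << Lgen (m + n)%R >>
      + ((m + n == 0)%:R * (12%:R^-1 * (m ^+ 3 - m)%:~R)) *: << CLgen >>
  | Igen m, Igen n =>
      (n%:~R * (m + n == 0)%:R) *: << CIgen >>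
  | Lgen m, Igen n =>
      n%:~R *: << Igen (m + n)%R >>
      + ((m + n == 0)%:R * (m ^+ 2 - m)%:~R) *: << CLIgen >>
  | Igen n, Lgen m =>
      - (n%:~R *: << Igen (m + n)%R >>
         + ((m + n == 0)%:R * (m ^+ 2 - m)%:~R) *: << CLIgen >>)
  | _, _ => 0
  end.

Definition hv_bracket (F : numFieldType) (x y : heisvir F) : heisvir F :=
  lin_ext (fun g => lin_ext (hv_gen_bracket F g) y) x.

Arguments hv_bracket {F} x y.

Section HeisVirLie.
Variable F : numFieldType.
Implicit Types x y z : heisvir F.

Lemma lmod_oppD2 (V : lmodType F) (u c : V) (a a' b b' : F) :
  a = - a' -> b = - b' -> a *: u + b *: c = - (a' *: u + b' *: c).
Proof. by move=> -> ->; rewrite opprD !scaleNr. Qed.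

Lemma hv_bracketUU g h :
  hv_bracket << g >> << h >> = hv_gen_bracket F g h.
Proof. by rewrite /hv_bracket !lin_extU. Qed.

Lemma hv_bracket_linearl y : linear (hv_bracket^~ y).
Proof. by move=> c u v; rewrite /hv_bracket linearP. Qed.

Lemma hv_bracket_linearr x : linear (hv_bracket x).
Proof.
move=> c u v; rewrite /hv_bracket.
apply: (@lin_ext_linearl F hv_gen (heisvir F) (heisvir F)
  (fun g => lin_ext (hv_gen_bracket F g)) v x c u) => g.
exact: lin_ext_linear.
Qed.

HB.instance Definition _ x := GRing.isLinear.Build F (heisvir F) (heisvir F)
  *:%R (hv_bracket x) (hv_bracket_linearr x).

Lemma hv_gen_bracketC g h : hv_gen_bracket F g h = - hv_gen_bracket F h g.
Proof.
case: g h => [m|m|||] [n|n|||] //=; rewrite ?oppr0 ?opprK //.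
- have -> : n + m = m + n by ring.
  apply: lmod_oppD2; first by ring.
  have [e|_] := eqVneq (m + n) 0; last by rewrite !mul0r oppr0.
  by rewrite -[n](addKr m) e addr0; ring.
- rewrite [n + m]addrC; have [e|_] := eqVneq (m + n) 0.
    have -> : n = - m by rewrite -[n](addKr m) e addr0.
    by rewrite -scaleNr rmorphN !mulr1.
  by rewrite !mulr0 scale0r oppr0.
Qed.

Lemma hv_bracketC x y : hv_bracket x y = - hv_bracket y x.
Proof.
move: x; apply: malg_linear_eq => [||g].
- exact: hv_bracket_linearl.
- by move=> c u v; rewrite linearP opprD scalerN.
move: y; apply: malg_linear_eq => [||h].
- exact: hv_bracket_linearr.
- by move=> c u v; rewrite hv_bracket_linearl opprD scalerN.
by rewrite !hv_bracketUU hv_gen_bracketC.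
Qed.

Lemma lmod_eqN (V : lmodType F) (v : V) : v = - v -> v = 0.
Proof.
move/eqP; rewrite -addr_eq0 -mulr2n -scaler_nat scaler_eq0.
by rewrite Num.Theory.pnatr_eq0 => /eqP.
Qed.

Lemma hv_bracketxx x : hv_bracket x x = 0.
Proof. by apply: lmod_eqN; apply: hv_bracketC. Qed.

Definition hv_jacobiator x y z : heisvir F := hv_bracket x (hv_bracket y z) + hv_bracket y (hv_bracket z x)
      + hv_bracket z (hv_bracket x y).

Lemma hv_jacobiator_rot x y z : hv_jacobiator x y z = hv_jacobiator y z x.
Proof. by rewrite /hv_jacobiator -addrA addrC. Qed.

Lemma hv_jacobiator_linear x y : linear (hv_jacobiator x y).
Proof.
move=> c u v; rewrite /hv_jacobiator.
have D3 (V : lmodType F) (a b d a' b' d' : V) :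
    c *: a + a' + (c *: b + b') + (c *: d + d')
      = c *: (a + b + d) + (a' + b' + d').
  by rewrite !scalerDr (addrACA (c *: a) a') (addrACA (c *: a + c *: b)).
by rewrite !(hv_bracket_linearl, hv_bracket_linearr) D3.
Qed.

Lemma lmod_comb2 (V : lmodType F) (u c : V) (a1 a2 a3 b1 b2 b3 : F) :
  a1 + a2 + a3 = 0 -> b1 + b2 + b3 = 0 ->
  (a1 *: u + b1 *: c) + (a2 *: u + b2 *: c) + (a3 *: u + b3 *: c) = 0.
Proof.
move=> a0 b0; rewrite (addrACA (a1 *: u)) -!scalerDl.
by rewrite (addrACA (_ *: u)) -!scalerDl a0 b0 !scale0r addr0.
Qed.

Lemma hv_bracketLL m n : hv_bracket << Lgen m >> << Lgen n >> =
  (n - m)%:~R *: << Lgen (m + n)%R >>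
  + ((m + n == 0)%:R * (12%:R^-1 * (m ^+ 3 - m)%:~R)) *: << CLgen >>
  :> heisvir F.
Proof. exact: hv_bracketUU. Qed.

Lemma hv_bracketII m n : hv_bracket << Igen m >> << Igen n >> =
  (n%:~R * (m + n == 0)%:R) *: << CIgen >> :> heisvir F.
Proof. exact: hv_bracketUU. Qed.

Lemma hv_bracketLI m n : hv_bracket << Lgen m >> << Igen n >> =
  n%:~R *: << Igen (m + n)%R >>
  + ((m + n == 0)%:R * (m ^+ 2 - m)%:~R) *: << CLIgen >> :> heisvir F.
Proof. exact: hv_bracketUU. Qed.

Lemma hv_bracketIL m n : hv_bracket << Igen n >> << Lgen m >> =
  (- n%:~R) *: << Igen (m + n)%R >>
  + (- ((m + n == 0)%:R * (m ^+ 2 - m)%:~R)) *: << CLIgen >> :> heisvir F.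
Proof. rewrite hv_bracketUU !scaleNr -opprD; reflexivity. Qed.

Definition hv_central (c : heisvir F) := forall x, hv_bracket x c = 0.

Lemma hv_centralP g : match g with Lgen _ | Igen _ => False | _ => True end ->
  hv_central << g >>.
Proof.
move=> cg x; apply: (malg_linear_eq (f := hv_bracket^~ << g >>) (g := fun=> 0)).
- exact: hv_bracket_linearl.
- by move=> c u v; rewrite scaler0 addr0.
by move=> h; rewrite hv_bracketUU; case: g h cg => [m|m|||] [n|n|||].
Qed.

Lemma hv_jacobi_central (c y z : heisvir F) : hv_central c ->
  hv_jacobiator c y z = 0.
Proof.
move=> cc; rewrite /hv_jacobiator cc (hv_bracketC c y) cc.
by rewrite (hv_bracketC c) cc oppr0 !linear0 !addr0.
Qed.

Lemma hv_bracketZD x a (u : heisvir F) b v : hv_bracket x (a *: u + b *: v)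
  = a *: hv_bracket x u + b *: hv_bracket x v.
Proof. by rewrite linearD !linearZ. Qed.

Lemma hv_bracketZ x a (u : heisvir F) :
  hv_bracket x (a *: u) = a *: hv_bracket x u.
Proof. exact: linearZ. Qed.

Let cCL := @hv_centralP CLgen I.
Let cCI := @hv_centralP CIgen I.
Let cCLI := @hv_centralP CLIgen I.

Lemma delta_eq (m : int) (a b : F) : (m = 0 -> a = b) ->
  (m == 0)%:R * a = (m == 0)%:R * b.
Proof. by case: eqP => [e ->|_ _] //; rewrite !mul0r. Qed.

Lemma int_elim (m n p : int) : m + (n + p) = 0 -> p = - (m + n).
Proof. by move=> e; apply/eqP; rewrite -addr_eq0 addrC -addrA e. Qed.

Lemma hv_jacobi_LLL m n p :
  hv_jacobiator << Lgen m >> << Lgen n >> << Lgen p >> = 0.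
Proof.
rewrite /hv_jacobiator !hv_bracketLL !hv_bracketZD !cCL !scaler0 !addr0.
rewrite !hv_bracketLL !scalerDr !scalerA.
have -> : n + (p + m) = m + (n + p) by ring.
have -> : p + (m + n) = m + (n + p) by ring.
apply: lmod_comb2; first by ring.
have [/int_elim ->|_] := eqVneq (m + (n + p)) 0; last by rewrite !mul0r !mulr0 !addr0.
by ring.
Qed.

Lemma hv_jacobi_LLI m n p :
  hv_jacobiator << Lgen m >> << Lgen n >> << Igen p >> = 0.
Proof.
rewrite /hv_jacobiator !hv_bracketLL !hv_bracketLI !hv_bracketIL.
rewrite !hv_bracketZD !cCL !cCLI !scaler0 !addr0.
rewrite !hv_bracketLI !hv_bracketIL !scalerDr !scalerA.
have -> : n + (m + p) = m + (n + p) by ring.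
have -> : m + n + p = m + (n + p) by ring.
apply: lmod_comb2; first by ring.
have [/int_elim ->|_] := eqVneq (m + (n + p)) 0; last by rewrite !mul0r ?oppr0 !mulr0 !addr0.
by ring.
Qed.

Lemma hv_jacobi_LII m n p :
  hv_jacobiator << Lgen m >> << Igen n >> << Igen p >> = 0.
Proof.
rewrite /hv_jacobiator !hv_bracketII !hv_bracketLI !hv_bracketIL.
rewrite !hv_bracketZD hv_bracketZ !cCI !cCLI !scaler0 !addr0 add0r.
rewrite !hv_bracketII !scalerA -scalerDl.
have -> : n + (m + p) = m + (n + p) by ring.
have -> : p + (m + n) = m + (n + p) by ring.
have [/int_elim ->|_] := eqVneq (m + (n + p)) 0; last by rewrite !mulr0 addr0 scale0r.
rewrite -[RHS](scale0r << CIgen >>); congr (_ *: _).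
by ring.
Qed.

Lemma hv_jacobi_III m n p :
  hv_jacobiator << Igen m >> << Igen n >> << Igen p >> = 0.
Proof.
by rewrite /hv_jacobiator !hv_bracketII !hv_bracketZ !cCI !scaler0 !addr0.
Qed.

Lemma hv_jacobi_gen f g h :
  hv_jacobiator << f >> << g >> << h >> = 0.
Proof.
have c1 c x y : hv_central c -> hv_jacobiator c x y = 0.
  exact: hv_jacobi_central.
have c2 c x y : hv_central c -> hv_jacobiator x c y = 0.
  by move=> ?; rewrite hv_jacobiator_rot; exact: c1.
have c3 c x y : hv_central c -> hv_jacobiator x y c = 0.
  by move=> ?; rewrite hv_jacobiator_rot; exact: c2.
case: f => [m|m|||]; [| |by apply: c1|by apply: c1|by apply: c1];
case: g => [n|n|||]; try (by apply: c2);
case: h => [p|p|||]; try (by apply: c3).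
- exact: hv_jacobi_LLL.
- exact: hv_jacobi_LLI.
- by rewrite -hv_jacobiator_rot; apply: hv_jacobi_LLI.
- exact: hv_jacobi_LII.
- by rewrite hv_jacobiator_rot; apply: hv_jacobi_LLI.
- by rewrite hv_jacobiator_rot; apply: hv_jacobi_LII.
- by rewrite -hv_jacobiator_rot; apply: hv_jacobi_LII.
- exact: hv_jacobi_III.
Qed.

Lemma hv_linear_eq0 (f : heisvir F -> heisvir F) : linear f ->
  (forall g, f << g >> = 0) -> forall x, f x = 0.
Proof.
move=> fl f0 x; apply: (malg_linear_eq (g := fun=> 0) fl _ f0).
by move=> c u v; rewrite scaler0 addr0.
Qed.

Lemma hv_jacobi x y z : hv_jacobiator x y z = 0.
Proof.
move: z; apply: hv_linear_eq0 (hv_jacobiator_linear x y) _ => h.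
rewrite -hv_jacobiator_rot; move: y.
apply: hv_linear_eq0 (hv_jacobiator_linear _ x) _ => g.
rewrite -hv_jacobiator_rot; move: x.
apply: hv_linear_eq0 (hv_jacobiator_linear _ _) _ => f.
exact: hv_jacobi_gen.
Qed.

HB.instance Definition _ := Lmodule_isLieAlgebra.Build F (heisvir F)
  hv_bracket_linearl hv_bracket_linearr hv_bracketxx hv_jacobi.
End HeisVirLie.

Definition hv_deg (g : hv_gen) : int :=
  match g with Lgen m | Igen m => m | _ => 0 end.

(* [hv_homog m x]: x lies in the component spanned by the generators of
   degree m. *)
Definition hv_homog (F : numFieldType) (m : int) (x : heisvir F) : Prop :=
  forall g, g \in msupp x -> hv_deg g = m.

(* Modules on the free space with basis v_t = << t >>, given by
   L(n) v_t = lc n t v_(n+t), I(n) v_t = ic n t v_(n+t), and CL, CI, CLI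
   acting as 0. *)
Section SeriesModule.
Variable F : numFieldType.
Variables lc ic : int -> int -> F.

Definition series_gen_act (g : hv_gen) (t : int) : {malg F[int]} :=
  match g with
  | Lgen n => lc n t *: << (n + t)%R >>
  | Igen n => ic n t *: << (n + t)%R >>
  | _ => 0
  end.

Definition series_act (x : heisvir F) (v : {malg F[int]}) : {malg F[int]} :=
  lin_ext (fun g => lin_ext (series_gen_act g) v) x.

Definition series_rel : Prop := forall m n t,
  [/\ lc n t * lc m (n + t) - lc m t * lc n (m + t)
        = (n - m)%:~R * lc (m + n) t,
      ic n t * ic m (n + t) = ic m t * ic n (m + t)
    & ic n t * lc m (n + t) - lc m t * ic n (m + t)
        = n%:~R * ic (m + n) t].

Lemma series_act_linearl v : linear (series_act^~ v).
Proof. by move=> c x y; rewrite /series_act linearP. Qed.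

Lemma series_act_linearr x : linear (series_act x).
Proof.
move=> c u v; rewrite /series_act.
apply: (@lin_ext_linearl F hv_gen {malg F[int]} {malg F[int]}
  (fun g => lin_ext (series_gen_act g)) v x c u) => g.
exact: lin_ext_linear.
Qed.

Lemma series_actU g t : series_act << g >> << t >> = series_gen_act g t.
Proof. by rewrite /series_act !lin_extU. Qed.

HB.instance Definition _ x := GRing.isLinear.Build F {malg F[int]} {malg F[int]}
  *:%R (series_act x) (series_act_linearr x).

Lemma series_actZ x c v : series_act x (c *: v) = c *: series_act x v.
Proof. exact: linearZ. Qed.

Lemma series_actZl c x v : series_act (c *: x) v = c *: series_act x v.
Proof. by rewrite /series_act; exact: linearZ. Qed.

Lemma series_actDl x y v : series_act (x + y) v = series_act x v + series_act y v.
Proof. by rewrite /series_act; exact: linearD. Qed.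

Lemma series_actNl x v : series_act (- x) v = - series_act x v.
Proof. by rewrite /series_act; exact: linearN. Qed.

Lemma series_act0l v : series_act 0 v = 0.
Proof. by rewrite /series_act; exact: linear0. Qed.

Hypothesis rel : series_rel.

Lemma series_act_gen g h t :
  series_act (hv_bracket << g >> << h >>) << t >>
    = series_act << g >> (series_act << h >> << t >>)
      - series_act << h >> (series_act << g >> << t >>).
Proof.
have a0 x : series_act x 0 = 0 by exact: linear0.
have actZU g' c t' :
    series_act << g' >> (c *: << t' >>) = c *: series_gen_act g' t'.
  by rewrite series_actZ series_actU.
have actZD (c c' : F) (g1 g2 : hv_gen) t' :
    series_act (c *: << g1 >> + c' *: << g2 >>) << t' >>
      = c *: series_gen_act g1 t' + c' *: series_gen_act g2 t'.
  apply: etrans (series_act_linearl _ _ _ _) _.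
  by rewrite series_actU; congr (_ + _); rewrite series_actZl series_actU.
have lcomp (k1 k2 k3 k4 k : F) (u v w : {malg F[int]}) : u = v -> w = v ->
    k = k1 * k2 - k3 * k4 ->
    k *: v = k1 *: (k2 *: u) - k3 *: (k4 *: w).
  by move=> -> -> ->; rewrite !scalerA -scalerBl.
have act_central g' v : (forall t', series_gen_act g' t' = 0) ->
    series_act << g' >> v = 0.
  move=> g0; move: v; apply: malg_linear_eq => [||t'].
  - exact: series_act_linearr.
  - by move=> c u w; rewrite scaler0 addr0.
  by rewrite series_actU g0.
rewrite hv_bracketUU !series_actU.
case: g h => [m|m|||] [n|n|||]; rewrite /series_gen_act ?a0
  ?(act_central CLgen) ?(act_central CIgen) ?(act_central CLIgen) ?subrr //;
  try exact: series_act0l.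
- apply: etrans (actZD _ _ _ _ _) _.
  rewrite scaler0 addr0 !actZU /= scalerA.
  apply: lcomp; [by congr << _ >>; ring|by congr << _ >>; ring|].
  by case: (rel m n t) => <- _ _; ring.
- apply: etrans (actZD _ _ _ _ _) _.
  rewrite scaler0 addr0 !actZU /= scalerA.
  apply: lcomp; [by congr << _ >>; ring|by congr << _ >>; ring|].
  by case: (rel m n t) => _ _ <-; ring.
- apply: etrans (series_actNl _ _) _.
  apply: etrans (congr1 -%R (actZD _ _ _ _ _)) _.
  rewrite scaler0 addr0 !actZU /= scalerA -scaleNr.
  apply: lcomp; [by congr << _ >>; ring|by congr << _ >>; ring|].
  by case: (rel n m t) => _ _ <-; ring.
- apply: etrans (series_actZl _ _ _) _; rewrite series_actU scaler0 !actZU /=.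
  rewrite -(scale0r << (m + (n + t))%R >>).
  apply: lcomp; [by []|by congr << _ >>; ring|].
  by case: (rel m n t) => _ -> _; rewrite subrr.
Qed.

Lemma series_act_bracket x y v :
  series_act (hv_bracket x y) v
    = series_act x (series_act y v) - series_act y (series_act x v).
Proof.
have BD (V : lmodType F) (c : F) (a b a' b' : V) :
    (c *: a + a') - (c *: b + b') = c *: (a - b) + (a' - b').
  by rewrite opprD scalerBr addrACA.
move: v; apply: malg_linear_eq => [||t].
- exact: series_act_linearr.
- by move=> c u v; rewrite !series_act_linearr BD.
move: y; apply: malg_linear_eq => [||h].
- by move=> c u v; rewrite hv_bracket_linearr series_act_linearl.
- by move=> c u v; rewrite !series_act_linearl series_act_linearr BD.
move: x; apply: malg_linear_eq => [||g].
- by move=> c u v; rewrite hv_bracket_linearl series_act_linearl.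
- by move=> c u v; rewrite !series_act_linearl series_act_linearr BD.
exact: series_act_gen.
Qed.

Definition series_module : lie_module (heisvir F) {malg F[int]} :=
  @LieModule F (heisvir F) {malg F[int]}
    series_act series_act_linearl series_act_linearr series_act_bracket.
End SeriesModule.

Section Families.
Variable F : numFieldType.
Implicit Types a b c d : F.

Lemma Aabc_rel a b c :
  series_rel (fun n t => a + t%:~R + b * n%:~R) (fun _ _ => c).
Proof. by move=> m n t; split; ring. Qed.

Definition mod_Aabc a b c := series_module (Aabc_rel a b c).


Ltac case_ifs := repeat match goal with
  |- context [if (?x == 0) then _ else _] =>
    let e := fresh "e" in
    have [e|e] := eqVneq x 0; try (exfalso; lia) end.

Ltac subst_int x :=
  match goal with
  | e : ?y = 0 |- _ =>
      lazymatch y with context [x] =>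
        first [ (have ? : x = 0 by lia)
              | match goal with z : int |- _ =>
                  first [constr_eq z x; fail 1 | have ? : x = z by lia] end
              | match goal with z : int |- _ => have ? : x = - z by lia end
              | match goal with z : int, w : int |- _ =>
                  have ? : x = - (z + w) by lia end ]; subst x
      end
  end.

Ltac series_tac :=
  let m := fresh "m" in let n := fresh "n" in let t := fresh "t" in
  move=> m n t; split; case_ifs;
  try subst_int t; try subst_int n; try subst_int m; ring.

Lemma Aad_rel a d :
  series_rel
    (fun n t => if t == 0 then n%:~R * (n%:~R + a) else (t + n)%:~R)
    (fun n t => if t == 0 then d * n%:~R else 0).
Proof. series_tac. Qed.

Definition mod_Aad a d := series_module (Aad_rel a d).

Lemma Bad_rel a d :
  series_rel
    (fun n t => if n + t == 0 then - n%:~R * (n%:~R + a) else t%:~R)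
    (fun n t => if n + t == 0 then d * n%:~R else 0).
Proof. series_tac. Qed.

Definition mod_Bad a d := series_module (Bad_rel a d).

Lemma U_rel d :
  series_rel
    (fun n t => t%:~R)
    (fun n t => if n + t == 0 then n%:~R * d else 0).
Proof. series_tac. Qed.

Definition mod_U d := series_module (U_rel d).

Lemma V_rel d :
  series_rel
    (fun n t => (t + n)%:~R)
    (fun n t => if t == 0 then n%:~R * d else 0).
Proof. series_tac. Qed.

Definition mod_V d := series_module (V_rel d).

Lemma Utilde_rel d :
  series_rel
    (fun n t => if n + t == 0 then 0 else t%:~R)
    (fun n t => if n + t == 0 then d * n%:~R else 0).
Proof. series_tac. Qed.

Definition mod_Utilde d := series_module (Utilde_rel d).

Lemma Vtilde_rel c :
  series_rel
    (fun n t => if n + t == 0 then 0 else t%:~R)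
    (fun n t => if t == 0 then if n == 0 then 0 else c else 0).
Proof. series_tac. Qed.

Definition mod_Vtilde c := series_module (Vtilde_rel c).
End Families.

(* Main.v *)
Require Import Defs.
From HB Require Import structures.
From mathcomp Require Import all_boot all_order all_algebra.
From mathcomp Require Import complex reals.
From mathcomp Require Import finmap boolp ring zify.
From mathcomp.multinomials Require Import monalg.

(* Idea. In a graded basis L(n) and I(n) are matrices E s t and J s t indexed by
   pairs of vertices, and the brackets become identities between paths
   s -> r -> t and s -> r' -> t with r + r' = s + t.  These are preserved by
   rescaling the basis and by transposition, which exchanges the tensor
   densities of parameters b and 1 - b.

   Indecomposability makes L(0) act by a + t and the central elements and I(0)
   by scalars.  The products of E around the edges {t, t + 1} and around the
   triangles t, t + 1, t + 2 are polynomials in a + t; comparing them kills the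
   central charge and determines b up to b <-> 1 - b.  Far to the right no edge
   vanishes, so after rescaling E is the density module of parameter b there.
   Every other vertex of nonzero weight (every vertex if b is not 0 or 1) is
   then attached to this tail in only one way, since its coefficients satisfy a
   linear recursion and have known products.  The action of I on the tail is
   constant up to exchanging b = 0 and b = 1, and spreads in the same manner.
   When b = 0 and some weight is 0, the vertex of weight 0 is adjoined last,
   which produces the exceptional families. *)

Set Implicit Arguments.
Unset Strict Implicit.
Unset Printing Implicit Defensive.

Import Order.TTheory GRing.Theory Num.Theory.
Local Open Scope ring_scope.

(** The obstacle is that coefficients may vanish, so no rescaling normalises all edges at once; only
    products along closed paths are independent of the basis. The two opposite triangles on t, t +
    1, t + 2 use the same three edges, and only the edge of length two sees the central charge; this
    yields an identity of polynomials valid at infinitely many weights.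

    The recursion at a new vertex leaves its first two coefficients free and is overdetermined from
    distance five on, where it forces the density solution except on a curve of pairs (weight, b).
    Products of outgoing and incoming coefficients settle that curve.

    The densities with b = 0 and b = 1 differ by rescaling v_t with its weight, so they agree away
    from weight 0. For b = 0 a vector of weight 0 spans a trivial submodule for the L(n), so
    relations through it degenerate: its L-coefficients form a two-parameter family, whose ratio
    becomes, up to sign, the parameter a of A(a, d) and B(a, d). *)

Section LinComb.
Variable F : comPzRingType.
Implicit Types k l r x y : F.

(** Certificates for equalities: the multipliers [k1], ... are supplied by hand, and [ring] or
    [field] checks the remaining identity. *)
Lemma lincomb1 k1 l1 r1 x y :
  l1 = r1 -> x - y = k1 * (l1 - r1) -> x = y.
Proof. by move=> ->; rewrite subrr mulr0 => /subr0_eq. Qed.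

Lemma lincomb2 k1 k2 l1 r1 l2 r2 x y : l1 = r1 -> l2 = r2 ->
  x - y = k1 * (l1 - r1) + k2 * (l2 - r2) -> x = y.
Proof. by move=> -> ->; rewrite !subrr !mulr0 !addr0 => /subr0_eq. Qed.

Lemma lincomb3 k1 k2 k3 l1 r1 l2 r2 l3 r3 x y :
  l1 = r1 -> l2 = r2 -> l3 = r3 ->
  x - y = k1 * (l1 - r1) + k2 * (l2 - r2) + k3 * (l3 - r3) -> x = y.
Proof. by move=> -> -> ->; rewrite !subrr !mulr0 !addr0 => /subr0_eq. Qed.

Lemma lincomb4 k1 k2 k3 k4 l1 r1 l2 r2 l3 r3 l4 r4 x y :
  l1 = r1 -> l2 = r2 -> l3 = r3 -> l4 = r4 ->
  x - y = k1 * (l1 - r1) + k2 * (l2 - r2) + k3 * (l3 - r3) + k4 * (l4 - r4) ->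
  x = y.
Proof. by move=> -> -> -> ->; rewrite !subrr !mulr0 !addr0 => /subr0_eq. Qed.

End LinComb.

(** * Linear recursions for the coefficients at a new vertex *)

Section ExtSeq.
Variable F : numFieldType.
Implicit Types (b x c : F) (u d : nat -> F).

(** The Witt relation from a vertex of weight [x] into a density tail of parameter [b] above it,
    [u n] being the coefficient of the step by n. The steps back satisfy it for [1 - b]. *)
Definition seq_rel b x u := forall n m : nat, (0 < n)%N -> (0 < m)%N ->
  u n * (x + n%:R + b * m%:R) - u m * (x + m%:R + b * n%:R)
    = (n%:R - m%:R) * u (n + m)%N.

Lemma seq_rel3 b x u : seq_rel b x u ->
  u 3 = u 2 * (x + 2 + b) - u 1 * (x + 1 + 2 * b).
Proof.
move=> /(_ 2 1 isT isT) /= e.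
by apply: (lincomb1 (k1 := -1) e); ring.
Qed.

Lemma seq_rel4 b x u : seq_rel b x u ->
  2 * u 4 = u 3 * (x + 3 + b) - u 1 * (x + 1 + 3 * b).
Proof.
move=> /(_ 3 1 isT isT) /= e.
by apply: (lincomb1 (k1 := -1) e); ring.
Qed.

(** The value [u 5] is reached both from 4 + 1 and from 3 + 2. The last factor is the determinant of
    [u 1], [u 2] against the density solution [x + b], [x + 2 * b]. *)
Lemma seq_rel5 b x u : seq_rel b x u ->
  ((x + b + 1) * (x + b + 2) - 6 * b)
    * ((x + b) * u 2 - (x + 2 * b) * u 1) = 0.
Proof.
move=> h; have e3 := seq_rel3 h; have e4 := seq_rel4 h.
have /= e5 := h 4 1 isT isT; have /= e6 := h 3 2 isT isT.
apply: (lincomb3 (k1 := 2) (k2 := -6) (k3 := - (x + 4 + b)) e5 e6 e4).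
by rewrite e3; ring.
Qed.

Lemma natS_neq0 (n : nat) : n.+1%:R != 0 :> F.
Proof. by rewrite pnatr_eq0. Qed.

Lemma seq_rel_prop b x u c : seq_rel b x u ->
  u 1 = c * (x + b) -> u 2 = c * (x + 2 * b) ->
  forall n, (0 < n)%N -> u n = c * (x + b * n%:R).
Proof.
move=> h h1 h2; suff H n : u n.+1 = c * (x + b * n.+1%:R) /\
  u n.+2 = c * (x + b * n.+2%:R).
  by case=> // n _; case: (H n).
elim: n => [|n [IH1 IH2]]; first by rewrite h1 h2; split; ring.
split=> //; apply: (mulfI (natS_neq0 n)).
have := h n.+2 1%N isT isT; rewrite addn1 IH2 h1 => e.
apply: (lincomb1 (k1 := -1) e); ring.
Qed.

(* [x + b n] has at most one zero, and the recursion recovers the value of [d]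
   that the product relation loses there. *)
Lemma seq_rel_dual b x u d c : b != 0 -> b != 1 -> c != 0 ->
  seq_rel (1 - b) x d ->
  (forall n, (0 < n)%N -> u n = c * (x + b * n%:R)) ->
  (forall n, (0 < n)%N ->
     u n * d n = (x + b * n%:R) * (x + (1 - b) * n%:R)) ->
  forall n, (0 < n)%N -> d n = c^-1 * (x + (1 - b) * n%:R).
Proof.
move=> b0 b1 c0 hd hu hp.
have dE n : (0 < n)%N -> x + b * n%:R != 0 ->
    d n = c^-1 * (x + (1 - b) * n%:R).
  move=> n0 pn; apply: (mulfI pn); apply: (mulfI c0).
  by rewrite mulrA -hu // hp // mulrCA [c * _]mulrA divff // mul1r.
have e3 := seq_rel3 hd.
have n2 : (2 : F) != 0 by rewrite pnatr_eq0.
have n3b : 3 * (1 - b) != 0.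
  by rewrite mulf_neq0 ?pnatr_eq0 // subr_eq0 eq_sym.
suff [d1 d2] : d 1 = c^-1 * (x + (1 - b)) /\ d 2 = c^-1 * (x + 2 * (1 - b)).
  exact: seq_rel_prop.
have [p1|p1] := eqVneq (x + b) 0; last first.
  have d1 : d 1 = c^-1 * (x + (1 - b)) by rewrite dE // mulr1.
  split=> //; have [p2|p2] := eqVneq (x + 2 * b) 0; last first.
    by rewrite dE; [congr (_ * _); ring | | rewrite mulrC in p2 *].
  have p3 : x + b * 3 != 0.
    apply: contra p1 => /eqP p3; apply/eqP.
    by apply: (lincomb2 (k1 := 2) (k2 := -1) p2 p3); ring.
  rewrite (dE 3) // d1 in e3.
  have xE : x = - (2 * b) by apply/eqP; rewrite -addr_eq0 p2.
  apply: (mulfI n3b).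
  by apply: (lincomb1 (k1 := -1) e3); rewrite xE; ring.
have xE : x = - b by apply/eqP; rewrite -addr_eq0 p1.
have p2 : x + b * 2 != 0 by rewrite xE (_ : _ + _ = b) //; ring.
have p3 : x + b * 3 != 0.
  by rewrite xE (_ : _ + _ = 2 * b) ?mulf_neq0 //; ring.
have d2 : d 2 = c^-1 * (x + 2 * (1 - b)) by rewrite dE //; congr (_ * _); ring.
split=> //; rewrite (dE 3) // d2 in e3.
apply: (mulfI n3b).
by apply: (lincomb1 (k1 := 1) e3); rewrite xE; ring.
Qed.

(** Each of the two affine factors has nonzero slope and so vanishes for at most one n; together
    they cannot cover n = 1, 2, 3. *)
Lemma seq_rel_not0 b x u d : b != 0 -> b != 1 ->
  (forall n, (0 < n)%N ->
     u n * d n = (x + b * n%:R) * (x + (1 - b) * n%:R)) ->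
  (forall n, (0 < n)%N -> u n = 0) -> False.
Proof.
move=> b0 b1 hp hu.
have sep (k z : F) : k != 0 -> forall m n : nat, m != n ->
    z + k * m%:R = 0 -> z + k * n%:R = 0 -> False.
  move=> kn m n mn em en.
  have : k * (m%:R - n%:R) = 0.
    by apply: (lincomb2 (k1 := 1) (k2 := -1) em en); ring.
  by move/eqP; rewrite mulf_eq0 subr_eq0 eqr_nat (negPf mn) (negPf kn).
have z n : (0 < n)%N -> (x + b * n%:R == 0) || (x + (1 - b) * n%:R == 0).
  by move=> n0; rewrite -mulf_eq0 -hp // hu // mul0r.
have b1' : 1 - b != 0 by rewrite subr_eq0 eq_sym.
have := z 1%N isT; have := z 2%N isT; have := z 3%N isT.
move: (sep _ x b0 1 2)%N (sep _ x b0 1 3)%N (sep _ x b0 2 3)%N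
   (sep _ x b1' 1 2)%N (sep _ x b1' 1 3)%N (sep _ x b1' 2 3)%N.
move=> s1 s2 s3 s4 s5 s6 /orP[]/eqP ? /orP[]/eqP ? /orP[]/eqP ?; auto.
Qed.

Lemma seq_rel_collinear b x u : seq_rel b x u ->
  b != 0 -> (x + b) * u 2 = (x + 2 * b) * u 1 ->
  exists c, forall n, (0 < n)%N -> u n = c * (x + b * n%:R).
Proof.
move=> h b0 w; have [p1|p1] := eqVneq (x + b) 0.
  have p2 : x + 2 * b != 0.
    by apply: contra_neq b0 => p2;
      apply: (lincomb2 (k1 := 1) (k2 := -1) p2 p1); ring.
  exists (u 2 / (x + 2 * b)); apply: seq_rel_prop => //; last by rewrite divfK.
  by apply: (mulfI p2); rewrite -w p1; ring.
exists (u 1%N / (x + b)); apply: seq_rel_prop => //; first by rewrite divfK.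
by apply: (mulfI p1); rewrite w; field.
Qed.

(* On the finitely many (x, b) where both recursions admit a second solution,
   the product relations for n <= 4 still force proportionality. *)
Lemma seq_rel_exceptional b x u d :
  seq_rel b x u -> seq_rel (1 - b) x d ->
  (forall n, (0 < n)%N ->
     u n * d n = (x + b * n%:R) * (x + (1 - b) * n%:R)) ->
  (x + b + 1) * (x + b + 2) - 6 * b = 0 ->
  (x + (1 - b) + 1) * (x + (1 - b) + 2) - 6 * (1 - b) = 0 ->
  (x + b) * u 2 = (x + 2 * b) * u 1.
Proof.
move=> hu hd hp g g'.
have n0 (n : nat) : n.+1%:R != 0 :> F by exact: natS_neq0.
have e3 := seq_rel3 hu; have e3' := seq_rel3 hd.
have e4 := seq_rel4 hu; have e4' := seq_rel4 hd.
have /= q1 := hp 1%N isT; have /= q2 := hp 2%N isT.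
have /= q3 := hp 3%N isT; have /= q4 := hp 4%N isT.
(* Subtracting [g'] from [g]: either x = 1, and then b^2 - b + 6 = 0 and (2 b - 1)^2 = -23, or b =
   1/2. *)
have /eqP : 2 * ((2 * b - 1) * (x - 1)) = 0.
  by apply: (lincomb2 (k1 := 1) (k2 := -1) g g'); ring.
rewrite !mulf_eq0 (negPf (n0 1%N)) /= => /orP[]/eqP hb; last first.
  have xE : x = 1 by apply: subr0_eq.
  rewrite {}xE in q1 q2 q3 q4 e3 e4 e3' e4' g g' *.
  have bb : b * b = b - 6 by apply: (lincomb1 (k1 := 1) g); ring.
  have d1 : d 1 != 0.
    suff: u 1 * d 1 != 0 by rewrite mulf_eq0 negb_or => /andP[].
    apply/eqP; rewrite q1 => z; have : (8 : F) == 0;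
      last by rewrite (negPf (n0 7)).
    by apply/eqP; apply: (lincomb2 (k1 := 1) (k2 := 1) z bb); ring.
  have b2 : 648 * (2 * b - 1) != 0.
    apply/eqP => z; have : (648 ^+ 2 * 23 : F) == 0.
      apply/eqP; apply:
        (lincomb2 (k1 := - (648 * (2 * b - 1))) (k2 := 4 * 648 ^+ 2) z bb).
      ring.
    by rewrite !mulf_eq0 ?(negPf (n0 _)).
  have q1' : u 1 * d 1 = 8 by rewrite q1; apply: (lincomb1 (k1 := -1) bb); ring.
  have q2' : u 2 * d 2 = 27 by rewrite q2; apply: (lincomb1 (k1 := -4) bb);
    ring.
  (* With the products at 1 and 2 known, those at 3 and 4 are linear in the mixed products [Q] and
     [Q']; eliminating [Q] leaves the factor 648 (2 b - 1). *)
  pose Q := u 1 * d 2; pose Q' := u 2 * d 1.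
  have l3 : (24 - 4 * b) * Q' + (20 + 4 * b) * Q = 684.
    rewrite e3 e3' in q3.
    apply: (lincomb4 (k1 := -1) (k2 := 18) (k3 := 32)
      (k4 := - (u 2 * d 2 + 4 * (u 1 * d 1) - 2 * Q' - 2 * Q - 9)) q3 q2' q1'
        bb).
    by rewrite /Q /Q'; ring.
  have f4 : 2 * u 4 = (8 * b + 6) * u 2 - (15 * b - 2) * u 1.
    by rewrite e4 e3; apply: (lincomb1 (k1 := u 2 - 2 * u 1) bb); ring.
  have f4' : 2 * d 4 = (14 - 8 * b) * d 2 - (13 - 15 * b) * d 1.
    by rewrite e4' e3'; apply: (lincomb1 (k1 := d 2 - 2 * d 1) bb); ring.
  have l4 : (798 - 106 * b) * Q' + (692 + 106 * b) * Q = 22824.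
    have q4' : (2 * u 4) * (2 * d 4) = 4 * ((1 + b * 4) * (1 + (1 - b) * 4)).
      by rewrite -q4; ring.
    rewrite f4 f4' in q4'.
    apply: (lincomb4 (k1 := -1) (k2 := 468) (k3 := 1324)
      (k4 := - (64 * (u 2 * d 2) + 225 * (u 1 * d 1) - 120 * Q' - 120 * Q - 64))
      q4' q2' q1' bb).
    by rewrite /Q /Q'; ring.
  have lQ : 648 * (2 * b - 1) * Q' = 18792 * b - 16848.
    by apply: (lincomb2 (k1 := 20 + 4 * b) (k2 := - (692 + 106 * b)) l4 l3);
      ring.
  apply: (mulIf d1); apply: (mulfI b2).
  apply: (lincomb3 (k1 := 1 + b) (k2 := - (648 * (2 * b - 1) * (1 + 2 * b)))
    (k3 := - 1944) lQ q1' bb).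
  by rewrite /Q'; ring.
have bE : 1 - b = b by apply: (lincomb1 (k1 := -1) hb); ring.
rewrite {}bE in hd hp g' e3' e4' q1 q2 q3 q4.
have p1 : x + b != 0.
  apply/eqP => z; have /eqP : (1 : F) = 0; last by rewrite oner_eq0.
  by apply: (lincomb3 (k1 := -1) (k2 := x + b + 3) (k3 := - 3) g z hb); ring.
have al : x + 2 + b != 0.
  apply/eqP => z; have /eqP : (3 : F) = 0; last by rewrite (negPf (n0 2)).
  by apply: (lincomb3 (k1 := -1) (k2 := x + b + 1) (k3 := - 3) g z hb); ring.
have be : x + 1 + 2 * b != 0.
  apply/eqP => z; have /eqP : (13 : F) = 0; last by rewrite (negPf (n0 12)).
  by apply: (lincomb3 (k1 := -4) (k2 := 4 * (x + 2)) (k3 := 2 * b - 13) g z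
    hb); ring.
have d1 : d 1 != 0.
  suff: u 1 * d 1 != 0 by rewrite mulf_eq0 negb_or => /andP[].
  by rewrite q1 mulr1 mulf_neq0.
pose Q := u 1 * d 2; pose Q' := u 2 * d 1.
have QQ : Q + Q' = 2 * ((x + b) * (x + 2 * b)).
  apply: (mulfI (mulf_neq0 al be)); rewrite e3 e3' in q3.
  apply: (lincomb3 (k1 := -1) (k2 := (x + 2 + b) ^+ 2)
    (k3 := (x + 1 + 2 * b) ^+ 2) q3 q2 q1).
  by rewrite /Q /Q'; ring.
(* [Q] and [Q'] have sum 2 K and product K^2 for K = (x + b)(x + 2 b), hence both equal K. *)
have Q'E : Q' = (x + b) * (x + 2 * b).
  apply/eqP; rewrite -subr_eq0 -sqrf_eq0; apply/eqP.
  apply: (lincomb3 (k1 := Q') (k2 := - (u 2 * d 2)) (k3 := - (x + b) ^+ 2) QQ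
    q1 q2).
  by rewrite /Q /Q'; ring.
apply: (mulIf d1).
apply: (lincomb2 (k1 := x + b) (k2 := - (x + 2 * b)) Q'E q1).
by rewrite /Q'; ring.
Qed.

(** One sequence of density form fixes the other through the products, so [seq_rel_exceptional] is
    needed only when the quadratic factor of [seq_rel5] vanishes for both. *)
Lemma seq_rel_classify b x u d :
  seq_rel b x u -> seq_rel (1 - b) x d ->
  (forall n, (0 < n)%N ->
     u n * d n = (x + b * n%:R) * (x + (1 - b) * n%:R)) ->
  b != 0 -> b != 1 ->
  exists2 c, c != 0 & forall n, (0 < n)%N ->
    u n = c * (x + b * n%:R) /\ d n = c^-1 * (x + (1 - b) * n%:R).
Proof.
move=> hu hd hp b0 b1.
have b0' : 1 - b != 0 by rewrite subr_eq0 eq_sym.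
have b1' : 1 - b != 1 by rewrite -subr_eq0 addrC addKr oppr_eq0.
have bK : 1 - (1 - b) = b by ring.
have fromu : (x + b) * u 2 = (x + 2 * b) * u 1 ->
    exists2 c, c != 0 & forall n, (0 < n)%N ->
    u n = c * (x + b * n%:R) /\ d n = c^-1 * (x + (1 - b) * n%:R).
  move=> /(seq_rel_collinear hu b0) [c uE].
  have c0 : c != 0.
    apply/eqP => cz; apply: (seq_rel_not0 b0 b1 hp) => n /uE ->.
    by rewrite cz mul0r.
  exists c => // n n0; split; first exact: uE.
  exact: (seq_rel_dual b0 b1 c0 hd uE hp).
have fromd : (x + (1 - b)) * d 2 = (x + 2 * (1 - b)) * d 1 ->
    exists2 c, c != 0 & forall n, (0 < n)%N ->
    u n = c * (x + b * n%:R) /\ d n = c^-1 * (x + (1 - b) * n%:R).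
  move=> /(seq_rel_collinear hd b0') [c dE].
  have hp' n : (0 < n)%N ->
      d n * u n = (x + (1 - b) * n%:R) * (x + (1 - (1 - b)) * n%:R).
    by move=> n0; rewrite mulrC hp // bK mulrC.
  have c0 : c != 0.
    apply/eqP => cz; apply: (seq_rel_not0 b0' b1' hp') => n /dE ->.
    by rewrite cz mul0r.
  exists c^-1; first by rewrite invr_eq0.
  move=> n n0; rewrite invrK; split; last exact: dE.
  rewrite -[in RHS]bK; apply: (seq_rel_dual b0' b1' c0 _ dE hp') => //.
  by rewrite bK.
have /eqP := seq_rel5 hu; rewrite mulf_eq0 [X in _ || X]subr_eq0.
case/orP => [/eqP g|/eqP]; last exact: fromu.
have /eqP := seq_rel5 hd; rewrite mulf_eq0 [X in _ || X]subr_eq0.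
case/orP => [/eqP g'|/eqP]; last exact: fromd.
exact/fromu/(seq_rel_exceptional hu hd hp).
Qed.

End ExtSeq.

(** * Virasoro invariants of edges and triangles *)

Section Progressions.
Variable F : numFieldType.

Lemma shift_const (P : int -> F) k : (forall t, P t = P (t - k)) ->
  forall t (n : nat), P (t + k * n%:Z) = P t.
Proof.
move=> h t; elim=> [|n IH]; first by rewrite mulr0 addr0.
by rewrite h -{}IH; congr P; rewrite intS; ring.
Qed.

Lemma shift1_const (P : int -> F) : (forall t, P t = P (t - 1)) ->
  forall t, P t = P 0.
Proof.
move=> h t; have e := shift_const h; case: (lerP 0 t) => t0.
  by rewrite -(e 0 `|t|%N); congr P; lia.
by rewrite -(e t `|t|%N); congr P; lia.
Qed.

Lemma poly_progression_eq0 (q : {poly F}) (y k : F) : k != 0 ->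
  (forall n : nat, q.[y + k * n%:R] = 0) -> forall z, q.[z] = 0.
Proof.
move=> k0 h z; suff -> : q = 0 by rewrite horner0.
apply/eqP; apply: contraT => q0.
pose f (n : nat) := y + k * n%:R.
have uf : uniq [seq f n | n <- iota 0 (size q)].
  rewrite map_inj_uniq ?iota_uniq // => m n /addrI /(mulfI k0) /eqP.
  by rewrite eqr_nat => /eqP.
have := max_poly_roots q0 _ uf; rewrite size_map size_iota ltnn => -> //.
by apply/allP => _ /mapP[n _ ->]; apply/eqP/h.
Qed.

End Progressions.

Section Virasoro.
Variable F : numClosedFieldType.
Implicit Types (a b c : F) (E : int -> int -> F) (r s t : int).

Definition wt a t : F := a + t%:~R.

Lemma wt_inj a : injective (wt a).
Proof. by move=> r s /addrI /eqP; rewrite eqr_int => /eqP. Qed.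

(* [E s t] is the coefficient of L(t - s) v_s at v_t. *)
Definition vir_rel a kap E :=
  (forall t, E t t = wt a t) /\
  forall s r r' t, r + r' = s + t ->
    E s r * E r t - E s r' * E r' t = (wt a r - wt a r') * E s t
      + (s == t)%:R
        * (12^-1 * ((wt a r' - wt a s) ^+ 3 - (wt a r' - wt a s)) * kap).

(** In [L(1), L(-1)] the cocycle m^3 - m vanishes, so the edge product grows by 2 [wt a t] whatever
    [kap] is. *)
Lemma vir_quadratic a kap E : vir_rel a kap E ->
  exists e, forall t, E t (t + 1) * E (t + 1) t = wt a t ^+ 2 + wt a t + e.
Proof.
case=> E0 h; pose P t := E t (t + 1) * E (t + 1) t - wt a t ^+ 2 - wt a t.
exists (P 0) => t.
suff H u : P u = P (u - 1) by rewrite -(shift1_const H t) /P; ring.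
move: u => {}t.
have e := h t (t + 1) (t - 1) t; rewrite eqxx E0 in e.
have {e}e := e ltac:(ring).
rewrite /P subrK; apply: (lincomb1 (k1 := 1) e); rewrite /wt; ring.
Qed.

(** The triangles based at t - 1 and t share the edge t, t + 1. One bracket gives their difference
    as three times the product of that edge, and summation leaves a cubic with an unknown
    constant. *)
Lemma vir_up a kap E e : vir_rel a kap E ->
  (forall t, E t (t + 1) * E (t + 1) t = wt a t ^+ 2 + wt a t + e) ->
  exists C, forall t, E t (t + 2) * E (t + 2) (t + 1) * E (t + 1) t
    = wt a t * (wt a t + 1) * (wt a t + 2) + 3 * e * wt a t + C.
Proof.
case=> E0 h g; pose P t := E t (t + 2) * E (t + 2) (t + 1) * E (t + 1) t
    - (wt a t * (wt a t + 1) * (wt a t + 2) + 3 * e * wt a t).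
exists (P 0) => t.
suff H u : P u = P (u - 1) by rewrite -(shift1_const H t) /P; ring.
move: u => {}t.
have h1 := h t (t + 2) (t - 1) (t + 1) ltac:(ring).
rewrite (_ : t == t + 1 = false) ?mul0r ?addr0 in h1; last lia.
rewrite /P (_ : t - 1 + 2 = t + 1) ?subrK; last ring.
apply: (lincomb2 (k1 := E (t + 1) t) (k2 := 3) h1 (g t)); rewrite /wt; ring.
Qed.

Lemma vir_down a kap E e : vir_rel a kap E ->
  (forall t, E t (t + 1) * E (t + 1) t = wt a t ^+ 2 + wt a t + e) ->
  exists C, forall t, E (t + 2) t * E t (t + 1) * E (t + 1) (t + 2)
    = wt a t * (wt a t + 1) * (wt a t + 2) + 3 * e * wt a t + C.
Proof.
case=> E0 h g; pose P t := E (t + 2) t * E t (t + 1) * E (t + 1) (t + 2)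
    - (wt a t * (wt a t + 1) * (wt a t + 2) + 3 * e * wt a t).
exists (P 0) => t.
suff H u : P u = P (u - 1) by rewrite -(shift1_const H t) /P; ring.
move: u => {}t.
have h1 := h (t + 1) (t + 2) (t - 1) t ltac:(ring).
rewrite (_ : t + 1 == t = false) ?mul0r ?addr0 in h1; last lia.
rewrite /P (_ : t - 1 + 2 = t + 1) ?subrK; last ring.
apply: (lincomb2 (k1 := E t (t + 1)) (k2 := 3) h1 (g t)); rewrite /wt; ring.
Qed.

(** Here [kap] enters, since the cocycle is nonzero on L(2), L(-2). This bracket compares vertices
    at distance 2, so one constant of summation serves one parity class only. *)
Lemma vir_even a kap E : vir_rel a kap E ->
  exists C, forall n : nat, let X := wt a (2 * n%:Z) in
    E (2 * n%:Z) (2 * n%:Z + 2) * E (2 * n%:Z + 2) (2 * n%:Z)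
      = X ^+ 2 + (2 - kap / 4) * X + C.
Proof.
case=> E0 h; pose P t := E t (t + 2) * E (t + 2) t
   - (wt a t ^+ 2 + (2 - kap / 4) * wt a t).
exists (P 0) => n X.
suff H t : P t = P (t - 2).
  by rewrite -(shift_const H 0 n) add0r /P -/X; ring.
have e := h t (t + 2) (t - 2) t; rewrite eqxx E0 in e.
have {e}e := e ltac:(ring).
rewrite mul1r in e; rewrite /P subrK; apply: (lincomb1 (k1 := 1) e).
have -> : wt a (t + 2) = wt a t + 2 by rewrite /wt; ring.
have -> : wt a (t - 2) = wt a t - 2 by rewrite /wt; ring.
by field.
Qed.

(** The origin of [b]: the edge product X^2 + X + e becomes (X + b)(X + 1 - b), which requires a
    square root. *)
Lemma quadratic_split (e : F) : exists b, e = b * (1 - b).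
Proof.
exists ((1 + sqrtC (1 - 4 * e)) / 2).
have s2 := sqrtCK (1 - 4 * e).
apply: (lincomb1 (k1 := 4^-1) s2); by field.
Qed.

(** Serves the case [D = 0] of [triangle_polynomial], where the special points no longer exclude a
    single nonzero constant. Cancelling common factors at positive integers leaves [M], whose values
    at 1, 2, 3 determine [B]. *)
Lemma cubic_rigidity (b B c0 : F) : b * (2 * b - 1) * (b - 1) = 0 ->
  (forall z, ((z + 1 - b) * (z + 2 - b) * (z + 2 * b) + B)
     * ((z + 1 - b) * (z + 2 - b) * (z + 2 * b))
     = (z ^+ 2 + 2 * z + c0) * (z + b) * (z + 1 - b) * (z + 1 + b)
       * (z + 2 - b)) -> B = 0.
Proof.
have n0 (n : nat) : n.+1%:R != 0 :> F by exact: natS_neq0.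
move/eqP; rewrite !mulf_eq0 -orbA => bE h.
have int_case : b = 0 \/ b = 1 -> B = 0.
  move=> b01; pose M z := z * (z + 1) * (z + 2) + B - (z ^+ 2 + 2 * z + c0)
    * (z + 1).
  have M0 n : M n.+1%:R = 0.
    apply: (mulfI (x := n.+1%:R * (n.+1%:R + 1) * (n.+1%:R + 2))).
      have nz k : n.+1%:R + k%:R != 0 :> F by rewrite -natrD pnatr_eq0.
      by rewrite !mulf_neq0 // ?(nz 1%N) ?(nz 2%N).
    have hn := h n.+1%:R.
    by case: b01 => b01; rewrite b01 in hn; apply: (lincomb1 (k1 := 1) hn);
      rewrite /M; ring.
  have -> : B = 6 * M 1 - 8 * M 2 + 3 * M 3 by rewrite /M; ring.
  by rewrite (M0 0%N) (M0 1%N) (M0 2%N); ring.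
case/or3P: bE => /eqP bE.
- by apply: int_case; left.
- have {}bE : b = 2^-1 by apply: (lincomb1 (k1 := 2^-1) bE); field.
  rewrite {}bE in h.
  pose M z := ((z + 2^-1) * (z + 1) * (z + 3 / 2) + B) * (z + 1)
     - (z ^+ 2 + 2 * z + c0) * (z + 2^-1) * (z + 3 / 2).
  have M0 n : M n.+1%:R = 0.
    apply: (mulfI (x := (2 * n.+1%:R + 1) * (2 * n.+1%:R + 3))).
      have nz k : 2 * n.+1%:R + k.+1%:R != 0 :> F.
        by rewrite -natrM -natrD pnatr_eq0 addnS.
      by rewrite mulf_neq0 // ?(nz 0%N) ?(nz 2%N).
    have hn := h n.+1%:R.
    by apply: (lincomb1 (k1 := 4) hn); rewrite /M; field.
  apply: (mulfI (n0 3)).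
  have -> : 4 * B = 35 * M 1 - 42 * M 2 + 15 * M 3 by rewrite /M; field.
  by rewrite (M0 0%N) (M0 1%N) (M0 2%N); ring.
by apply: int_case; right; apply: subr0_eq.
Qed.

(* On the left the two triangle products, known up to the constants [C] and
   [C']; on the right the same edges grouped differently. *)
Lemma triangle_polynomial (b C C' k c0 : F) :
  (forall z, ((z + 1 - b) * (z + 2 - b) * (z + 2 * b) + C)
     * ((z + b) * (z + 1 + b) * (z + 2 - 2 * b) + C')
   = (z ^+ 2 + (2 - k) * z + c0) * (z + b) * (z + 1 - b) * (z + 1 + b)
       * (z + 2 - b)) ->
  let D := 2 * b * (2 * b - 1) * (b - 1) in
  k = 0 /\ ((C = 0 /\ C' = 0) \/ (C = - D /\ C' = D)).
Proof.
move=> h D.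
have n0 (n : nat) : n.+1%:R != 0 :> F by exact: natS_neq0.
pose L z := ((z + 1 - b) * (z + 2 - b) * (z + 2 * b) + C)
     * ((z + b) * (z + 1 + b) * (z + 2 - 2 * b) + C')
   - (z ^+ 2 + (2 - k) * z + c0) * (z + b) * (z + 1 - b) * (z + 1 + b)
       * (z + 2 - b).
have L0 z : L z = 0 by rewrite /L h subrr.
(* The terms of degree 6 cancel and z^5 has coefficient [k]; the fifth difference extracts 120
   [k]. *)
have k0 : k = 0.
  apply: (mulfI (n0 119)); rewrite mulr0.
  transitivity (L 5 - 5 * L 4 + 10 * L 3 - 10 * L 2 + 5 * L 1 - L 0).
    by rewrite /L; ring.
  by rewrite !L0; ring.
split=> //; rewrite {}k0 in h L L0.
(* At z = b - 1, and below at z = - b, the right side vanishes together with one of the cubics on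
   the left. *)
have /eqP : C * (C' - D) = 0.
  by have := h (b - 1) => e; apply: (lincomb1 (k1 := 1) e); rewrite /D; ring.
have /eqP : (C + D) * C' = 0.
  by have := h (- b) => e; apply: (lincomb1 (k1 := 1) e); rewrite /D; ring.
rewrite !mulf_eq0 subr_eq0 addr_eq0.
have d0 : D = 0 -> (C = 0 -> C' = 0) /\ (C' = 0 -> C = 0).
  move=> D0; have b0 : b * (2 * b - 1) * (b - 1) = 0.
    by apply: (mulfI (n0 1%N)); rewrite mulr0 -[RHS]D0 /D; ring.
  have KK z : (z + b) * (z + 1 + b) * (z + 2 - 2 * b)
      = (z + 1 - b) * (z + 2 - b) * (z + 2 * b).
    by apply: (lincomb1 (k1 := -1) D0); rewrite /D; ring.
  by split=> e; apply: (cubic_rigidity (c0 := c0) b0) => z; have := h z;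
    rewrite e KK subr0 addr0 => <-; ring.
have [Cz|Cn] := eqVneq C 0; have [Cz'|Cn'] := eqVneq C' 0 => //=; first by left.
- rewrite Cz orbF eq_sym oppr_eq0 => /eqP /d0 [/(_ Cz) Cz' _].
  by rewrite Cz' eqxx in Cn'.
- rewrite Cz' => _ /eqP /esym /d0 [_ /(_ Cz') Cz].
  by rewrite Cz eqxx in Cn.
by rewrite orbF => /eqP -> /eqP ->; right.
Qed.

(* [b] and [1 - b] give the same edge products; the triangles decide between
   them, and do not distinguish 0 from 1. *)
Lemma vir_invariants a kap E : vir_rel a kap E -> kap = 0 /\
  exists2 b, b != 1 & forall t, let X := wt a t in
    [/\ E t (t + 1) * E (t + 1) t = (X + b) * (X + 1 - b),
        E t (t + 2) * E (t + 2) (t + 1) * E (t + 1) t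
          = (X + 1 - b) * (X + 2 - b) * (X + 2 * b)
      & E (t + 2) t * E t (t + 1) * E (t + 1) (t + 2)
          = (X + b) * (X + 1 + b) * (X + 2 - 2 * b)].
Proof.
move=> h.
have [e g] := vir_quadratic h; have [C up] := vir_up h g.
have [C' down] := vir_down h g; have [c0 ev] := vir_even h.
have [b eE] := quadratic_split e; rewrite {}eE in g up down.
(* [D1] and [D2] are the values at X = 0 of the cubics of the density module; [C - D1] and [C' - D2]
   measure the deviation from it. *)
pose D1 := (1 - b) * (2 - b) * (2 * b).
pose D2 := b * (1 + b) * (2 - 2 * b).
have upE t : E t (t + 2) * E (t + 2) (t + 1) * E (t + 1) t
    = (wt a t + 1 - b) * (wt a t + 2 - b) * (wt a t + 2 * b) + (C - D1).
  by rewrite up /D1; ring.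
have downE t : E (t + 2) t * E t (t + 1) * E (t + 1) (t + 2)
    = (wt a t + b) * (wt a t + 1 + b) * (wt a t + 2 - 2 * b) + (C' - D2).
  by rewrite down /D2; ring.
pose q : {poly F} := (('X + (1 - b)%:P) * ('X + (2 - b)%:P) * ('X + (2 * b)%:P)
  + (C - D1)%:P)
     * (('X + b%:P) * ('X + (1 + b)%:P) * ('X + (2 - 2 * b)%:P) + (C' - D2)%:P)
   - ('X ^+ 2 + (2 - kap / 4)%:P * 'X + c0%:P) * ('X + b%:P)
     * ('X + (1 - b)%:P) * ('X + (1 + b)%:P)
       * ('X + (2 - b)%:P).
have qE z : q.[z] = ((z + 1 - b) * (z + 2 - b) * (z + 2 * b) + (C - D1))
     * ((z + b) * (z + 1 + b) * (z + 2 - 2 * b) + (C' - D2))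
   - (z ^+ 2 + (2 - kap / 4) * z + c0) * (z + b) * (z + 1 - b) * (z + 1 + b)
       * (z + 2 - b).
  by rewrite /q expr2 !(hornerD, hornerN, hornerM, hornerX, hornerC) -expr2;
    ring.
have q0 : forall z, q.[z] = 0.
  apply: (@poly_progression_eq0 _ q a 2) => [|n]; first by rewrite pnatr_eq0.
  rewrite qE; have -> : a + 2 * n%:R = wt a (2 * n%:Z) by rewrite /wt; ring.
  rewrite -upE -downE -ev.
  have g1 := g (2 * n%:Z); have g2 := g (2 * n%:Z + 1).
  rewrite (_ : _ + 1 + 1 = 2 * n%:Z + 2) in g2; last ring.
  set A := E (_ + 1) (_ + 2) in g2 *; set A' := E (_ + 2) (_ + 1) in g2 *.
  set B := E _ (_ + 1) in g1 *; set B' := E (_ + 1) _ in g1 *.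
  set P := E _ _; set P' := E _ _; set X := wt _ _.
  have XE : wt a (2 * n%:Z + 1) = X + 1 by rewrite /X /wt; ring.
  rewrite XE -/X in g1 g2.
  apply: (lincomb2 (k1 := P * P' * (A * A'))
    (k2 := P * P' * (X ^+ 2 + X + b * (1 - b))) g1 g2).
  ring.
have /triangle_polynomial[k0 CC] : forall z,
    ((z + 1 - b) * (z + 2 - b) * (z + 2 * b) + (C - D1))
     * ((z + b) * (z + 1 + b) * (z + 2 - 2 * b) + (C' - D2))
   = (z ^+ 2 + (2 - kap / 4) * z + c0) * (z + b) * (z + 1 - b) * (z + 1 + b)
       * (z + 2 - b).
  by move=> z; have := q0 z; rewrite qE => /subr0_eq.
split.
  have n4 : (4^-1 : F) != 0 by rewrite invr_eq0 pnatr_eq0.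
  by move/eqP: k0; rewrite mulf_eq0 (negPf n4) orbF => /eqP.
have {CC}[d upD downD] : exists2 d : F, True & forall t, let X := wt a t in
   [/\ E t (t + 1) * E (t + 1) t = (X + d) * (X + 1 - d),
        E t (t + 2) * E (t + 2) (t + 1) * E (t + 1) t
          = (X + 1 - d) * (X + 2 - d) * (X + 2 * d)
      & E (t + 2) t * E t (t + 1) * E (t + 1) (t + 2)
          = (X + d) * (X + 1 + d) * (X + 2 - 2 * d)].
  case: CC => -[c1 c2]; [exists b | exists (1 - b)] => // t X; split.
  - by rewrite g /X; ring.
  - by rewrite upE c1 addr0.
  - by rewrite downE c2 addr0.
  - by rewrite g /X; ring.
  - by rewrite upE c1 /X; ring.
  - by rewrite downE c2 /X; ring.
have [d1|] := eqVneq d 1; last by exists d.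
exists 0; first by rewrite eq_sym oner_eq0.
move=> t X; have [-> -> ->] := downD t.
by rewrite -/X d1; split; ring.
Qed.

End Virasoro.

(** * Attaching vertices to a tail *)

Section Witt.
Variable F : numClosedFieldType.
Implicit Types (a b : F) (E : int -> int -> F) (r s t T w : int).

Definition witt_rel a E :=
  (forall t, E t t = wt a t) /\
  forall s r r' t, r + r' = s + t ->
    E s r * E r t - E s r' * E r' t = (wt a r - wt a r') * E s t.

Definition transp E r t : F := E t r.

(** The coefficients in the basis [c t *: v_t]. *)
Definition gauge (c : int -> F) E r t := c r / c t * E r t.

(** The density coefficient in terms of the weights [X] of the source and [Y] of the target, so that
    reversing arrows just replaces [b] by [1 - b]. *)
Definition dens b (X Y : F) := X + b * (Y - X).

Definition tail_dens a b E T :=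
  forall r t, T <= r -> T <= t -> E r t = dens b (wt a r) (wt a t).

(* Rescaling v_w by [c] makes all coefficients between v_w and the tail
   equal to those of the tensor density module. *)
Definition attached a b E T w c := forall y, T <= y ->
  c * E w y = dens b (wt a w) (wt a y) /\ E y w = c * dens b (wt a y) (wt a w).

Lemma wtD a t (k : int) : wt a (t + k) = wt a t + k%:~R.
Proof. by rewrite /wt intrD addrA. Qed.

Lemma wt_dist a r t : r <= t -> wt a t = wt a r + `|t - r|%N%:R.
Proof. by move=> rt; rewrite /wt natr_absz ger0_norm ?subr_ge0 //; ring. Qed.

Lemma wt_add a r r' s t : r + r' = s + t -> wt a r' = wt a s + wt a t - wt a r.
Proof. by move=> e; rewrite /wt (_ : r' = s + t - r); [ring | lia]. Qed.

Lemma witt_transp a E : witt_rel a E -> witt_rel a (transp E).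
Proof.
case=> E0 h; split=> [t|s r r' t e]; first exact: E0.
by rewrite /transp mulrC [E r' s * _]mulrC; apply: h; rewrite e addrC.
Qed.

Lemma witt_gauge a c E : (forall t, c t != 0) -> witt_rel a E ->
  witt_rel a (gauge c E).
Proof.
move=> c0 [E0 h]; split=> [t|s r r' t e];
  first by rewrite /gauge divff // mul1r.
have H u : gauge c E s u * gauge c E u t = c s / c t * (E s u * E u t).
  by rewrite /gauge; field; rewrite !c0.
by rewrite !H -mulrBr (h _ _ _ _ e) mulrCA.
Qed.

Lemma tail_dens_le a b E T T' : T <= T' -> tail_dens a b E T ->
  tail_dens a b E T'.
Proof. by move=> TT h r t rT tT; apply: h; apply: le_trans TT _. Qed.

Lemma dens_transp b (X Y : F) : dens (1 - b) X Y = dens b Y X.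
Proof. by rewrite /dens; ring. Qed.

Lemma tail_transp a b E T : tail_dens a b E T ->
  tail_dens a (1 - b) (transp E) T.
Proof. by move=> h r t rT tT; rewrite /transp h // dens_transp. Qed.

Lemma eventually_wt_neq a (z : F) : exists T, forall t, T <= t -> wt a t != z.
Proof.
have [[t0 <-]|no] := EM (exists t0, wt a t0 = z).
  exists (t0 + 1) => t tT; rewrite (inj_eq (@wt_inj _ a)); lia.
by exists 0 => t _; apply/eqP => e; apply: no; exists t.
Qed.

Lemma tail_up a b E T : witt_rel a E ->
  (forall t, T <= t -> E t (t + 1) = wt a t + b /\
    E t (t + 2) = wt a t + 2 * b) ->
  forall (n : nat) r, T <= r -> E r (r + n%:Z) = wt a r + b * n%:R.
Proof.
case=> E0 h st; suff H n r : T <= r -> E r (r + n.+1%:Z) = wt a r + b * n.+1%:R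
    /\ E r (r + n.+2%:Z) = wt a r + b * n.+2%:R.
  by case=> [|n] r rT; [rewrite addr0 E0 mulr0 addr0 | case: (H n r rT)].
elim: n r => [|n IH] r rT; first by have [-> ->] := st r rT; split; ring.
have [_ e1] := IH r rT; split=> //.
have e2 : E (r + 1) (r + n.+3%:Z) = wt a (r + 1) + b * n.+2%:R.
  have [_ <-] := IH (r + 1) ltac:(lia); congr (E _ _); lia.
have e3 : E (r + n.+2%:Z) (r + n.+3%:Z) = wt a (r + n.+2%:Z) + b.
  have [<- _] := st (r + n.+2%:Z) ltac:(lia); congr (E _ _); lia.
have [e4 _] := st r rT.
have := h r (r + n.+2%:Z) (r + 1) (r + n.+3%:Z) ltac:(lia).
rewrite e1 e2 e3 e4 => e; apply: (mulfI (natS_neq0 F n)).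
by apply: (lincomb1 (k1 := -1) e); rewrite !wtD; ring.
Qed.

(** [L(1), L(n + 2)] is a nonzero multiple of L(n + 3), so steps of length one and two determine all
    longer ones; the downward steps follow by transposition. *)
Lemma tail_of_steps a b E T : witt_rel a E ->
  (forall t, T <= t -> E t (t + 1) = wt a t + b /\
    E t (t + 2) = wt a t + 2 * b) ->
  (forall t, T <= t -> E (t + 1) t = wt a t + 1 - b
     /\ E (t + 2) t = wt a t + 2 - 2 * b) ->
  tail_dens a b E T.
Proof.
move=> h up down r t rT tT; have [rt|tr] := lerP r t.
  have := tail_up h up `|t - r|%N rT.
  rewrite (_ : r + _ = t); last lia.
  by move=> ->; rewrite /dens (wt_dist a rt); ring.
have dn u : T <= u -> transp E u (u + 1) = wt a u + (1 - b)
    /\ transp E u (u + 2) = wt a u + 2 * (1 - b).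
  by move=> uT; have [e1 e2] := down u uT; rewrite /transp e1 e2; split; ring.
have := tail_up (witt_transp h) dn `|r - t|%N tT.
rewrite (_ : t + _ = r); last lia.
by rewrite /transp => ->; rewrite /dens (wt_dist a (ltW tr)); ring.
Qed.

Lemma tail_gauge a b E : witt_rel a E ->
  (forall t, let X := wt a t in
    [/\ E t (t + 1) * E (t + 1) t = (X + b) * (X + 1 - b),
        E t (t + 2) * E (t + 2) (t + 1) * E (t + 1) t
          = (X + 1 - b) * (X + 2 - b) * (X + 2 * b)
      & E (t + 2) t * E t (t + 1) * E (t + 1) (t + 2)
          = (X + b) * (X + 1 + b) * (X + 2 - 2 * b)]) ->
  exists c T, (forall t, c t != 0) /\ tail_dens a b (gauge c E) T.
Proof.
move=> h inv.
have [T1 hT1] := eventually_wt_neq a (- b).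
have [T2 hT2] := eventually_wt_neq a (b - 1).
pose T : int := Num.max T1 T2.
have n1 t : T <= t -> wt a t + b != 0.
  by rewrite addr_eq0 ge_max => /andP[/hT1].
have n2 t : T <= t -> wt a t + 1 - b != 0.
  by rewrite -addrA addr_eq0 opprB ge_max => /andP[_ /hT2].
pose rho t := E t (t + 1) / (wt a t + b).
have En t : T <= t -> E t (t + 1) != 0.
  move=> tT; have [e _ _] := inv t.
  have : E t (t + 1) * E (t + 1) t != 0 by rewrite e mulf_neq0 ?n1 ?n2.
  by rewrite mulf_eq0 negb_or => /andP[].
have rho0 t : T <= t -> rho t != 0.
  by move=> tT; rewrite mulf_neq0 ?invr_eq0 ?n1 ?En.
(* Partial products of the corrections [rho] normalise all upward edges from [T] on; the value 1
   below [T] is a placeholder. *)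
pose c t := if T <= t then \prod_(i < absz (t - T)%R) rho (T + i%:Z) else 1.
have c0 t : c t != 0.
  rewrite /c; case: ifP => _; last exact: oner_neq0.
  by apply/prodf_neq0 => i _; apply: rho0; lia.
have cS t : T <= t -> c (t + 1) = c t * rho t.
  move=> tT; rewrite /c tT (_ : T <= t + 1); last lia.
  rewrite (_ : absz (t + 1 - T)%R = (absz (t - T)%R).+1); last lia.
  by rewrite big_ord_recr /=; congr (_ * rho _); lia.
exists c, T; split=> //; set E' := gauge c E.
have h' : witt_rel a E' by apply: witt_gauge.
have g1 t : T <= t -> E' t (t + 1) = wt a t + b.
  move=> tT; rewrite /E' /gauge cS // /rho; field.
  by rewrite c0 En // n1.
have inv' t : let X := wt a t in
    [/\ E' t (t + 1) * E' (t + 1) t = (X + b) * (X + 1 - b),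
        E' t (t + 2) * E' (t + 2) (t + 1) * E' (t + 1) t
          = (X + 1 - b) * (X + 2 - b) * (X + 2 * b)
      & E' (t + 2) t * E' t (t + 1) * E' (t + 1) (t + 2)
          = (X + b) * (X + 1 + b) * (X + 2 - 2 * b)].
  move=> X; have [e1 e2 e3] := inv t; rewrite /X -e1 -e2 -e3 /E' /gauge.
  by split; field; rewrite !c0.
have g2 t : T <= t -> E' (t + 1) t = wt a t + 1 - b.
  move=> tT; have [e _ _] := inv' t; apply: (mulfI (n1 t tT)).
  by rewrite -{1}g1.
have X1 t : wt a (t + 1) = wt a t + 1 by rewrite wtD.
apply: tail_of_steps h' _ _ => t tT; split; rewrite ?g1 ?g2 //.
(* The triangle gives the step of length two, its other two edges being known and nonzero. *)
- have [_ e _] := inv' t.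
  have := g2 (t + 1) ltac:(lia); rewrite (_ : t + 1 + 1 = t + 2); last ring.
  move=> e'; rewrite e' g2 // X1 in e.
  have nz : (wt a t + 1 + 1 - b) * (wt a t + 1 - b) != 0.
    by rewrite mulf_neq0 ?n2 // -X1 n2 //; lia.
  by apply: (mulIf nz); apply: (lincomb1 (k1 := 1) e); ring.
have [_ _ e] := inv' t.
have := g1 (t + 1) ltac:(lia); rewrite (_ : t + 1 + 1 = t + 2); last ring.
move=> e'; rewrite e' g1 // X1 in e.
have nz : (wt a t + b) * (wt a t + 1 + b) != 0.
  by rewrite mulf_neq0 ?n1 // -X1 n1 //; lia.
by apply: (mulIf nz); apply: (lincomb1 (k1 := 1) e); ring.
Qed.

(** The bracket of L(n) and L(-n) makes the defect [P] periodic of period n, and it vanishes in the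
    tail. Hence the formula holds at every vertex, before any attachment. *)
Lemma edge_product a b E T : witt_rel a E -> tail_dens a b E T ->
  forall w (n : nat), (0 < n)%N ->
  E w (w + n%:Z) * E (w + n%:Z) w
    = (wt a w + b * n%:R) * (wt a w + (1 - b) * n%:R).
Proof.
case=> E0 h ht w n n0.
pose P t := E t (t + n%:Z) * E (t + n%:Z) t
   - (wt a t + b * n%:R) * (wt a t + (1 - b) * n%:R).
suff : P w = 0 by move/subr0_eq.
have hP t : P t = P (t - n%:Z).
  have e := h t (t + n%:Z) (t - n%:Z) t ltac:(ring).
  rewrite /P subrK; apply: (lincomb1 (k1 := 1) e).
  by rewrite E0 !wtD; ring.
rewrite -(shift_const hP w `|T - w|); set t := w + _.
have tT : T <= t by rewrite /t; nia.
have tT' : T <= t + n%:Z by lia.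
by rewrite /P !ht // wtD /dens; ring.
Qed.

Lemma attach_below a b E T w : witt_rel a E -> tail_dens a b E T ->
  b != 0 -> b != 1 -> T = w + 1 ->
  exists2 c, c != 0 & attached a b E T w c.
Proof.
move=> hE ht b0 b1 TE.
pose u (n : nat) := E w (w + n%:Z); pose d (n : nat) := E (w + n%:Z) w.
have [E0 h] := hE.
have Emn (m n : nat) : (0 < m)%N -> (0 < n)%N ->
    E (w + m%:Z) (w + (m + n)%N%:Z) = wt a w + m%:R + b * n%:R
    /\ E (w + (m + n)%N%:Z) (w + m%:Z) = wt a w + m%:R + (1 - b) * n%:R.
  move=> m0 n0; have [h1 h2] : T <= w + m%:Z /\ T <= w + (m + n)%N%:Z by lia.
  by rewrite !ht // !wtD; split; rewrite /dens; ring.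
have hu : seq_rel b (wt a w) u.
  move=> n m n0 m0; have [e1 _] := Emn n m n0 m0; have [e2 _] := Emn m n m0 n0.
  rewrite /u -e1 -e2 [(m + n)%N]addnC.
  rewrite h ?wtD; [ring | lia].
have hd : seq_rel (1 - b) (wt a w) d.
  move=> n m n0 m0; have [_ e1] := Emn n m n0 m0; have [_ e2] := Emn m n m0 n0.
  rewrite /d -e1 -e2 [(m + n)%N]addnC mulrC [X in _ - X]mulrC.
  rewrite h ?wtD; [ring | lia].
have [c c0 uE] := seq_rel_classify hu hd (edge_product hE ht w) b0 b1.
exists c^-1; first by rewrite invr_eq0.
move=> y yT; have wy : w <= y by lia.
have yE : y = w + `|y - w|%N%:Z by lia.
have [e1 e2] := uE `|y - w|%N ltac:(lia).
rewrite (wt_dist a wy); move: e1 e2; rewrite /u /d -yE => -> ->.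
by split; rewrite /dens; [field | ring].
Qed.

(** [seq_rel_classify] wants every vertex above w in the tail, so vertices are absorbed downwards
    one at a time. The scalars stay 1 from [T] on, so that the result refers to the original
    tail. *)
Lemma attach_all a b E T : witt_rel a E -> tail_dens a b E T ->
  b != 0 -> b != 1 -> forall w, exists2 c, c != 0 & attached a b E T w c.
Proof.
move=> hE ht b0 b1.
have ext (k : nat) : exists c, [/\ forall t, c t != 0,
    forall t, T <= t -> c t = 1 & tail_dens a b (gauge c E) (T - k%:Z)].
  elim: k => [|k [c [c0 c1 hc]]].
    exists (fun=> 1); split=> // [_|r t rT tT]; first exact: oner_neq0.
    by rewrite /gauge divr1 mul1r ht //; lia.
  have hE' := witt_gauge c0 hE.
  pose w := T - k.+1%:Z.
  have [|d d0 hd] := attach_below (w := w) hE' hc b0 b1; first by rewrite /w;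
    lia.
  pose c' t := if t == w then d * c w else c t.
  exists c'; split=> [t|t tT|r t rT tT].
  - by rewrite /c'; case: ifP => _ //; rewrite mulf_neq0.
  - by rewrite /c' ifF ?c1 // /w; lia.
  have hlt u : T - k.+1%:Z <= u -> u != w -> T - k%:Z <= u.
    by rewrite /w => ? /eqP ?; lia.
  rewrite /gauge /c'; case: eqP => [->|/eqP rw]; case: eqP => [->|/eqP tw].
  - by rewrite divff ?mulf_neq0 // mul1r (proj1 hE) /dens; ring.
  - have [<- _] := hd t (hlt _ tT tw); rewrite /gauge; field.
    exact: c0.
  - have [_ e] := hd r (hlt _ rT rw).
    transitivity (d^-1 * gauge c E r w); last by rewrite e mulKf.
    by rewrite /gauge; field; rewrite d0 c0.
  by rewrite -hc ?hlt.
move=> w; have [wT|wT] := lerP T w.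
  exists 1; first exact: oner_neq0.
  by move=> y yT; rewrite !mul1r !ht.
have [c [c0 c1 hc]] := ext `|T - w|%N.
exists (c w) => // y yT.
have [e1 e2] : gauge c E w y = dens b (wt a w) (wt a y)
   /\ gauge c E y w = dens b (wt a y) (wt a w) by split; apply: hc; lia.
by rewrite -e1 -e2 /gauge (c1 y yT); split; field; rewrite ?c0.
Qed.

Lemma dens_neq0_large a b (X : F) (M : int) : (b != 0) || (X != 0) ->
  exists2 z, M <= z & dens b X (wt a z) != 0.
Proof.
have [->|b0 _] := eqVneq b 0; first by move=> X0; exists M;
  rewrite // /dens mul0r addr0.
have [e|ne] := eqVneq (dens b X (wt a M)) 0; last by exists M.
exists (M + 1); first lia.
have -> : dens b X (wt a (M + 1)) = dens b X (wt a M) + b.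
  by rewrite /dens wtD; ring.
by rewrite e add0r.
Qed.

(** The path r, t, z is compared with r, r + z - t, z, which is known for z far out. Cancelling the
    edge t, z needs [dens b (wt a t) (wt a z)] nonzero, which is why [N] avoids weight 0 when b =
    0. *)
Lemma attach_glue a b E T (N : int -> Prop) :
  witt_rel a E -> tail_dens a b E T -> 
  (forall w, N w -> (b != 0) || (wt a w != 0)) ->
  (forall w, N w -> exists2 c, c != 0 & attached a b E T w c) ->
  exists2 c, forall t, c t != 0 &
    forall r t, N r -> N t -> gauge c E r t = dens b (wt a r) (wt a t).
Proof.
move=> hE ht hN hatt.
have /choice[c hc] w : exists c, c != 0 /\ (N w -> attached a b E T w c).
  have [/hatt[c c0 hc]|nN] := EM (N w); first by exists c.
  by exists 1; split=> //; exact: oner_neq0.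
have c0 t : c t != 0 by case: (hc t).
exists c => // r t Nr Nt.
have [_ /(_ Nr) ar] := hc r; have [_ /(_ Nt) at_] := hc t.
have [z zM dz] := dens_neq0_large a (Num.max T (T + t - r)) (hN t Nt).
have zT : T <= z by move: zM; rewrite ge_max => /andP[].
have yT : T <= r + z - t by move: zM; rewrite ge_max => /andP[_]; lia.
have e := (proj2 hE) r t (r + z - t) z ltac:(ring).
have [e1 _] := ar z zT; have [e2 _] := at_ z zT.
have [e3 _] := ar _ yT; rewrite (ht (r + z - t) z) // in e.
apply: (mulIf dz); rewrite -{1}e2 /gauge.
have {e} : c r * (E r t * E t z) = dens b (wt a r) (wt a t) * dens b (wt a t)
  (wt a z).
  have -> : E r t * E t z = E r (r + z - t) * dens b (wt a (r + z - t)) (wt a z)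
     + (wt a t - wt a (r + z - t)) * E r z by rewrite -e; ring.
  rewrite mulrDr mulrA e3 mulrCA e1 /dens
    (_ : wt a (r + z - t) = wt a r + wt a z - wt a t).
    by ring.
  by apply: wt_add; ring.
by move=> <-; field; apply: c0.
Qed.

Lemma quadratic_tail a (phi : int -> F) T :
  (forall t, T <= t ->
     phi (t + 3) - 3 * phi (t + 2) + 3 * phi (t + 1) - phi t = 0) ->
  exists A B C, forall t, T <= t -> phi t = A + B * wt a t + C * wt a t ^+ 2.
Proof.
move=> h; pose X := wt a T.
pose C := (phi (T + 2) - 2 * phi (T + 1) + phi T) / 2.
pose B := phi (T + 1) - phi T - C * (2 * X + 1).
pose A := phi T - B * X - C * X ^+ 2.
exists A, B, C => t tT; pose Q u := A + B * wt a u + C * wt a u ^+ 2.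
suff H (n : nat) : [/\ phi (T + n%:Z) = Q (T + n%:Z),
    phi (T + n%:Z + 1) = Q (T + n%:Z + 1) & phi (T + n%:Z + 2) = Q
      (T + n%:Z + 2)].
  by have [e _ _] := H `|t - T|%N; rewrite (_ : t = T + `|t - T|%N%:Z) //; lia.
elim: n => [|n [IH1 IH2 IH3]].
  by rewrite addr0 /Q !wtD -/X /A /B /C; split; field.
rewrite (_ : T + n.+1%:Z = T + n%:Z + 1); last lia.
set t' := T + n%:Z in IH1 IH2 IH3 *.
rewrite (_ : t' + 1 + 1 = t' + 2); last ring.
rewrite (_ : t' + 1 + 2 = t' + 3); last ring.
split=> //; have e := h t' ltac:(lia).
rewrite IH1 IH2 IH3 in e.
by apply: (lincomb1 (k1 := 1) e); rewrite /Q !wtD; ring.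
Qed.

(* The chord slope of [wt * G] between y and y' depends on y + y' only, so
   [wt * G] is quadratic, and comparison with its slope makes [G] constant. *)
Lemma chord_const a w T (G : int -> F) :
  (forall t, T <= t -> wt a t != 0) -> wt a w != 0 ->
  (forall y y' z, T <= y -> T <= y' -> T <= z -> y + y' = w + z ->
     wt a y * G y - wt a y' * G y' = (wt a y - wt a y') * G z) ->
  exists B, forall y, T <= y -> G y = B.
Proof.
move=> nz w0 h; pose T' : int := `|T| + `|w|.
have [|A [B [C hq]]] := @quadratic_tail a (fun t => wt a t * G t) T'.
  move=> t tT; rewrite /T' in tT.
  (* The chords t, t + 3 and t + 1, t + 2 have the same sum, hence the same slope; comparing them
     gives a third difference. *)
  have e1 := h (t + 3) t (2 * t + 3 - w) ltac:(lia) ltac:(lia) ltac:(lia)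
    ltac:(lia).
  have e2 := h (t + 2) (t + 1) (2 * t + 3 - w) ltac:(lia) ltac:(lia) ltac:(lia)
    ltac:(lia).
  by apply: (lincomb2 (k1 := 1) (k2 := -3) e1 e2); rewrite !wtD; ring.
have GE z : 2 * T' + 1 - w <= z -> T' <= z ->
    G z = B + C * (wt a z + wt a w) /\ A = C * wt a w * wt a z.
  move=> zT zT'; pose y := z + w - T'.
  have e := h y T' z ltac:(lia) ltac:(lia) ltac:(lia) ltac:(lia).
  rewrite !hq in e; [|lia..].
  have d : wt a y - wt a T' != 0.
    by rewrite subr_eq0 (inj_eq (@wt_inj _ a)); lia.
  have yE : wt a y = wt a w + wt a z - wt a T' by apply: wt_add; lia.
  have Gz : G z = B + C * (wt a z + wt a w).
    apply: (mulfI d); rewrite -e yE; ring.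
  split=> //; have e2 := hq z zT'; rewrite Gz in e2.
  by apply: (lincomb1 (k1 := -1) e2); ring.
pose Z : int := 3 * T' + `|w| + 1.
have [GZ AZ] := GE Z ltac:(lia) ltac:(lia).
have [_ AZ'] := GE (Z + 1) ltac:(lia) ltac:(lia).
have /eqP : C * wt a w = 0.
  by apply: (lincomb2 (k1 := 1) (k2 := -1) AZ AZ'); rewrite wtD; ring.
rewrite mulf_eq0 (negPf w0) orbF => /eqP C0.
have A0 : A = 0 by rewrite AZ C0 !mul0r.
have GT' y : T' <= y -> G y = B.
  move=> yT; apply: (mulfI (nz y ltac:(lia))).
  by rewrite hq // A0 C0; ring.
exists B => y yT; pose y' : int := `|T'| + `|w| + `|y|.
have e := h y y' (y + y' - w) ltac:(lia) ltac:(lia) ltac:(lia) ltac:(lia).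
rewrite (GT' y') ?(GT' (y + y' - w)) in e; [|lia..].
apply: (mulfI (nz y yT)).
by apply: (lincomb1 (k1 := 1) e); ring.
Qed.

(** Replaces [attach_all] for b = 0. By [chord_const], [E w y] and [E y w / wt a y] are constants
    [B] and [B']; [edge_product] gives B B' = [wt a w], so neither vanishes. *)
Lemma attach_functions a E T w : witt_rel a E -> tail_dens a 0 E T ->
  (forall t, T <= t -> wt a t != 0) -> wt a w != 0 ->
  exists2 c, c != 0 & attached a 0 E T w c.
Proof.
move=> hE ht nz w0.
have ht' r t : T <= r -> T <= t -> E r t = wt a r.
  by move=> rT tT; rewrite ht // /dens mul0r addr0.
have [|B hB] := @chord_const a w T (E w) nz w0.
  move=> y y' z yT yT' zT e; have := (proj2 hE) w y y' z e.
  by rewrite (ht' y z) // (ht' y' z) // => <-; ring.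
have [|B' hB'] := @chord_const a w T (fun y => E y w / wt a y) nz w0.
  move=> y y' z yT yT' zT e; have := (proj2 hE) z y y' w ltac:(lia).
  rewrite (ht' z y) // (ht' z y') // => e'.
  have cK u : T <= u -> wt a u * (E u w / wt a u) = E u w.
    by move=> uT; rewrite mulrC divfK ?nz.
  rewrite !cK //; apply: (mulfI (nz z zT)).
  by rewrite mulrBr e'; field; apply: nz.
have d y : T <= y -> E y w = B' * wt a y.
  by move=> yT; rewrite -(hB' y yT) divfK ?nz.
have BB : B * B' = wt a w.
  pose y : int := `|T| + `|w| + 1.
  have yT : T <= y by lia.
  have := edge_product hE ht w (n := `|y - w|) ltac:(lia).
  rewrite (_ : w + _ = y); last lia.
  rewrite hB // d // mul0r addr0 subr0 mul1r -wt_dist; last lia.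
  by rewrite mulrA => /(mulIf (nz y yT)).
have B0 : B != 0 by apply: contra_neq w0 => B0; rewrite -BB B0 mul0r.
have B'0 : B' != 0 by apply: contra_neq w0 => B'0; rewrite -BB B'0 mulr0.
exists B' => // y yT; rewrite hB // d // /dens.
by split; [rewrite -BB; ring | ring].
Qed.

Lemma gauge_comp c d E r t : (forall t, c t != 0) -> (forall t, d t != 0) ->
  gauge c (gauge d E) r t = gauge (fun t => c t * d t) E r t.
Proof. by move=> c0 d0; rewrite /gauge; field; rewrite c0 d0. Qed.

Lemma witt_normal_form a b E : witt_rel a E -> b != 1 ->
  (forall t, let X := wt a t in
    [/\ E t (t + 1) * E (t + 1) t = (X + b) * (X + 1 - b),
        E t (t + 2) * E (t + 2) (t + 1) * E (t + 1) t
          = (X + 1 - b) * (X + 2 - b) * (X + 2 * b)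
      & E (t + 2) t * E t (t + 1) * E (t + 1) (t + 2)
          = (X + b) * (X + 1 + b) * (X + 2 - 2 * b)]) ->
  exists2 c, forall t, c t != 0 & forall r t,
    (b != 0) || (wt a r != 0) -> (b != 0) || (wt a t != 0) ->
    gauge c E r t = dens b (wt a r) (wt a t).
Proof.
move=> hE b1 /(tail_gauge hE)[d [T [d0 ht]]].
have hE' := witt_gauge d0 hE.
have [T0 hT0] := eventually_wt_neq a 0.
pose T' : int := Num.max T T0.
have ht' : tail_dens a b (gauge d E) T' by apply: tail_dens_le ht; lia.
pose N w : Prop := (b != 0) || (wt a w != 0).
have [|c c0 hc] := @attach_glue a b _ T' N hE' ht' (fun w h => h).
  move=> w Nw; have [bz|bn] := eqVneq b 0.
    rewrite bz in ht' Nw *; apply: attach_functions hE' ht' _ _ => [t tT|].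
      by apply: hT0; lia.
    by move: Nw; rewrite /N bz eqxx.
  exact: attach_all hE' ht' bn b1 w.
exists (fun t => c t * d t) => [t|r t Nr Nt]; first by rewrite mulf_neq0.
by rewrite -gauge_comp // hc.
Qed.

End Witt.

(** * The Heisenberg part *)

Section HeisVir.
Variable F : numClosedFieldType.
Implicit Types (a b zet eta k : F) (E J : int -> int -> F) (r s t T w : int).

(* [J s t] is the coefficient of I(t - s) v_s at v_t. *)
Definition li_rel a zet E J := forall s r r' t, r + r' = s + t ->
  J s r * E r t - E s r' * J r' t = (wt a r - wt a s) * J s t
    + (s == t)%:R * (((wt a t - wt a r) ^+ 2 - (wt a t - wt a r)) * zet).

Definition ii_rel a eta J := forall s r r' t, r + r' = s + t ->
  J s r * J r t - J s r' * J r' t = (s == t)%:R * ((wt a r - wt a s) * eta).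

Definition heis_rel a zet eta k E J :=
  [/\ forall t, J t t = k, li_rel a zet E J & ii_rel a eta J].

Lemma heis_gauge a zet eta k E J (c : int -> F) : (forall t, c t != 0) ->
  heis_rel a zet eta k E J -> heis_rel a zet eta k (gauge c E) (gauge c J).
Proof.
move=> c0 [J0 LI II].
have H (A B : int -> int -> F) s u t :
    gauge c A s u * gauge c B u t = c s / c t * (A s u * B u t).
  by rewrite /gauge; field; rewrite !c0.
have D s t z : c s / c t * ((s == t)%:R * z) = (s == t)%:R * z.
  by case: eqP => [->|_]; rewrite ?mul0r ?mulr0 // divff // mul1r.
split=> [t|s r r' t e|s r r' t e].
- by rewrite /gauge divff // mul1r.
- by rewrite !H -mulrBr (LI _ _ _ _ e) mulrDr D mulrCA.
by rewrite !H -mulrBr (II _ _ _ _ e) D.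
Qed.

Lemma li0 a E J : li_rel a 0 E J -> forall s r r' t, r + r' = s + t ->
  J s r * E r t - E s r' * J r' t = (wt a r - wt a s) * J s t.
Proof. by move=> LI s r r' t e; rewrite (LI _ _ _ _ e) !mulr0 addr0. Qed.

Lemma ii0 a J : ii_rel a 0 J -> forall s r r' t, r + r' = s + t ->
  J s r * J r t = J s r' * J r' t.
Proof.
by move=> II s r r' t e; apply/subr0_eq; rewrite (II _ _ _ _ e) !mulr0.
Qed.

Lemma li_transp a E J : li_rel a 0 E J -> li_rel a 0 (transp E) (transp J).
Proof.
move=> LI s r r' t e; have := li0 LI (s := t) (r := r') (r' := r) (t := s).
rewrite /transp !mulr0 addr0 => /(_ ltac:(lia)) e'.
by apply: (lincomb1 (k1 := -1) e'); rewrite (wt_add a e); ring.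
Qed.

Lemma heis_transp a k E J :
  heis_rel a 0 0 k E J -> heis_rel a 0 0 k (transp E) (transp J).
Proof.
case=> J0 LI II; split; [exact: J0 | exact: li_transp |].
move=> s r r' t e; rewrite !mulr0 /transp mulrC [J r' s * _]mulrC.
by rewrite (ii0 II (r := r) (r' := r')) ?subrr //; lia.
Qed.

Lemma tail_const (P : int -> F) T : (forall t, T <= t -> P (t + 1) = P t) ->
  forall t, T <= t -> P t = P T.
Proof.
move=> h t tT; rewrite (_ : t = T + `|t - T|%N%:Z); last lia.
elim: `|t - T|%N => [|n IH]; first by rewrite addr0.
by rewrite -IH -(h (T + n%:Z)); [congr P|]; lia.
Qed.

Lemma tail_const2 (P : int -> F) T : (forall t, T <= t -> P (t + 2) = P t) ->
  forall n : nat, P (T + 2 * n%:Z) = P T.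
Proof.
move=> h; elim=> [|n IH]; first by rewrite mulr0 addr0.
by rewrite -IH -(h (T + 2 * n%:Z)); [congr P|]; lia.
Qed.

(** Closed paths of length one and two determine the products of [J] with [E] up to constants. Since
    [L(1), I(1)] = I(2), these constants satisfy a polynomial identity [q] in the weight. Its
    coefficient of z^3 is [- zet], and its value at b - 1 is 2 b (1 - b) [de]. *)
Lemma heis_step_up a b zet k E J T :
  (forall t, J t t = k) -> li_rel a zet E J -> tail_dens a b E T ->
  zet = 0 /\ exists2 de, b * (1 - b) * de = 0 & forall t, T < t ->
    J t (t + 1) * (wt a t + 1 - b) = k * (wt a t + 1 - b) + de.
Proof.
move=> J0 LI ht; pose k1 := k + 2 * zet.
pose A t := J t (t + 1) * (wt a t + 1 - b) - k1 * wt a t.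
pose B t := J t (t + 2) * (wt a t + 2 - 2 * b) - (2 * k + 6 * zet) / 2 * wt a t.
have [A1 AE] : exists A1, forall t, T < t -> A t = A1.
  exists (A (T + 1)) => t tT; apply: tail_const => [{}t {}tT|]; last lia.
  have := LI (t + 1) (t + 1 + 1) t (t + 1) ltac:(lia).
  rewrite eqxx mul1r J0 !ht ?wtD ?/dens; [|lia..] => e.
  by apply: (lincomb1 (k1 := 1) e); rewrite /A !wtD /k1; ring.
have [B1 BE] : exists B1, forall n : nat, B (T + 1 + 2 * n%:Z) = B1.
  exists (B (T + 1)); apply: tail_const2 => t tT.
  have := LI (t + 2) (t + 2 + 2) t (t + 2) ltac:(lia).
  rewrite eqxx mul1r J0 !ht ?wtD ?/dens; [|lia..] => e.
  by apply: (lincomb1 (k1 := 1) e); rewrite /B !wtD; field.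
pose de := A1 - k1 * (1 - b).
have JE t : T < t -> J t (t + 1) * (wt a t + 1 - b) = k1 * (wt a t + 1 - b)
  + de.
  by move=> tT; rewrite /de -(AE t tT) /A; ring.
pose q : {poly F} := ((k1 *: 'X + A1%:P) * ('X + (1 + b)%:P) * ('X + (2 - b)%:P)
   - ('X + b%:P) * (k1 *: ('X + 1) + A1%:P) * ('X + (1 - b)%:P))
     * ('X + (2 - 2 * b)%:P)
   - ((k + 3 * zet) *: 'X + B1%:P) * ('X + (1 - b)%:P) * ('X + (2 - b)%:P).
have qE z : q.[z] = ((k1 * z + A1) * (z + 1 + b) * (z + 2 - b)
   - (z + b) * (k1 * (z + 1) + A1) * (z + 1 - b)) * (z + 2 - 2 * b)
   - ((k + 3 * zet) * z + B1) * (z + 1 - b) * (z + 2 - b).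
  by rewrite /q !(hornerD, hornerN, hornerM, hornerX, hornerC, hornerZ); ring.
have q0 : forall z, q.[z] = 0.
  apply: (@poly_progression_eq0 _ q (wt a (T + 1)) 2) => [|n];
    first by rewrite pnatr_eq0.
  have [t tE] : exists t, t = T + 1 + 2 * n%:Z by eexists.
  rewrite qE; have -> : wt a (T + 1) + 2 * n%:R = wt a t by rewrite tE /wt;
    ring.
  have e := LI t (t + 1) (t + 1) (t + 2) ltac:(lia).
  rewrite (_ : t == t + 2 = false) ?mul0r ?addr0 in e; last lia.
  rewrite !ht ?wtD ?/dens in e; [|lia..].
  have a1 := AE t ltac:(lia).
  have a2 := AE (t + 1) ltac:(lia).
  have b1 := BE n; rewrite -tE /B in b1.
  rewrite /A (_ : t + 1 + 1 = t + 2) ?wtD in a1 a2; last ring.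
  set X := wt a t in e a1 a2 b1 *.
  have u1 : k1 * X + A1 = J t (t + 1) * (X + 1 - b).
    by rewrite -a1; ring.
  have u2 : k1 * (X + 1) + A1 = J (t + 1) (t + 2) * (X + 2 - b).
    by rewrite -a2; ring.
  have u3 : (k + 3 * zet) * X + B1 = J t (t + 2) * (X + 2 - 2 * b).
    by rewrite -b1; field.
  apply: (lincomb4 (k1 := (X + 1 - b) * (X + 2 - b) * (X + 2 - 2 * b))
    (k2 := (X + 1 + b) * (X + 2 - b) * (X + 2 - 2 * b))
    (k3 := - ((X + b) * (X + 1 - b) * (X + 2 - 2 * b)))
    (k4 := - ((X + 1 - b) * (X + 2 - b))) e u1 u2 u3).
  by ring.
have z0 : zet = 0.
  apply: (mulfI (natS_neq0 F 5)); rewrite mulr0.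
  transitivity (- (q.[3] - 3 * q.[2] + 3 * q.[1] - q.[0])).
    by rewrite !qE /k1; ring.
  by rewrite !q0; ring.
split=> //; exists de; last by move=> t tT; rewrite JE // /k1 z0 mulr0 addr0.
apply: (mulfI (natS_neq0 F 1)); rewrite mulr0 -(q0 (b - 1)) qE /de; ring.
Qed.

(** For b = 0 a second solution [de = - k] survives: it is the module with b = 1 and constant [J],
    whose [E] takes the form b = 0 after rescaling by the weights. *)
Lemma heis_tail a b zet eta k E J T : b != 1 ->
  tail_dens a b E T -> heis_rel a zet eta k E J ->
  [/\ zet = 0, eta = 0 & exists T', (forall t, T' <= t ->
        J t (t + 1) = k /\ J (t + 1) t = k)
    \/ b = 0 /\ (forall t, T' <= t ->
        J t (t + 1) * wt a (t + 1) = k * wt a t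
        /\ J (t + 1) t * wt a t = k * wt a (t + 1))].
Proof.
move=> b1 ht [J0 LI II].
have [z0 [de b_de up]] := heis_step_up J0 LI ht; rewrite {}z0 in LI *.
have [_ [de' b_de' down]] := heis_step_up J0 (li_transp LI) (tail_transp ht).
have [T1 hT1] := eventually_wt_neq a 0.
have [T2 hT2] := eventually_wt_neq a (- b).
have [T3 hT3] := eventually_wt_neq a (b - 1).
pose T0 : int := Num.max (T + 1) (Num.max T1 (Num.max T2 T3)).
have nz t : T0 <= t ->
  [/\ T < t, wt a t != 0, wt a t + b != 0 & wt a t + 1 - b != 0].
  move=> tT; split; first lia.
  - by apply: hT1; lia.
  - by rewrite addr_eq0; apply: hT2; lia.
  - by rewrite -addrA addr_eq0 opprB; apply: hT3; lia.
have {}down t : T < t -> J (t + 1) t * (wt a t + b) = k * (wt a t + b) + de'.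
  move/down; rewrite /transp => e; apply: (lincomb1 (k1 := 1) e); ring.
(* Between neighbouring edges the product of opposite [J] coefficients jumps by [eta]. *)
have eta0 T' : (forall t, T' <= t -> J t (t + 1) * J (t + 1) t = k ^+ 2) ->
  eta = 0.
  move=> h; have := II T' (T' + 1) (T' - 1) T' ltac:(lia).
  have := II (T' + 1) (T' + 1 + 1) T' (T' + 1) ltac:(lia).
  rewrite eqxx mul1r (h (T' + 1)) ?[J _ T' * _]mulrC ?h //; last lia.
  by rewrite subrr wtD => e _; apply: (lincomb1 (k1 := -1) e); ring.
have good : de = 0 -> de' = 0 -> forall t, T0 <= t ->
    J t (t + 1) = k /\ J (t + 1) t = k.
  move=> d0 d0' t /nz[tT _ n1 n2]; split.
    by apply: (mulIf n2); rewrite up // d0 addr0.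
  by apply: (mulIf n1); rewrite down // d0' addr0.
have [bz|bn] := eqVneq b 0; last first.
  have bb : b * (1 - b) != 0 by rewrite mulf_neq0 // subr_eq0 eq_sym.
  have d0 : de = 0 by apply: (mulfI bb); rewrite b_de mulr0.
  have d0' : de' = 0 by apply: (mulfI bb); rewrite mulr0 -b_de'; ring.
  have g := good d0 d0'; split=> //; last by exists T0; left.
  by apply: (eta0 T0) => t /g[-> ->].
rewrite bz in ht up down nz.
have ht' r t : T <= r -> T <= t -> E r t = wt a r.
  by move=> rT tT; rewrite ht // /dens mul0r addr0.
(* A bracket mixing upward and downward steps links the two corrections. *)
have dd : de' = - de.
  have [t tT] : exists t, T + 1 < t by exists (T + 2); lia.
  have e := li0 LI (s := t) (r := t - 1) (r' := t + 2) (t := t + 1) ltac:(lia).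
  have e1 := up t ltac:(lia); have e2 := down (t - 1) ltac:(lia).
  have e3 := down (t + 1) ltac:(lia).
  rewrite !ht' in e; [|lia..].
  rewrite subrK in e2; rewrite (_ : t + 1 + 1 = t + 2) in e3; last ring.
  rewrite !wtD in e e1 e2 e3;
  apply: (lincomb4 (k1 := wt a t + 1) (k2 := -1) (k3 := - (wt a t + 1))
    (k4 := wt a t) e e1 e2 e3).
  by ring.
(* I(1) and I(2) commute on the way from t to t + 3; writing I(2) as [L(1), I(1)] leaves a quadratic
   condition on [de]. *)
have /eqP : de * (k + de) = 0.
  have [t tT] : exists t, T0 <= t by exists T0.
  have [tT1 _ _ n1] := nz t tT.
  have [tT2 _ _ n2] := nz (t + 1) ltac:(lia).
  have [tT3 _ _ n3] := nz (t + 2) ltac:(lia).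
  have e0 := up t tT1; have e1 := up (t + 1) tT2; have e2 := up (t + 2) tT3.
  rewrite (_ : t + 1 + 1 = t + 2) in e1; last ring.
  rewrite (_ : t + 2 + 1 = t + 3) in e2; last ring.
  have f0 := li0 LI (s := t) (r := t + 1) (r' := t + 1) (t := t + 2) ltac:(lia).
  have f1 := li0 LI (s := t + 1) (r := t + 2) (r' := t + 2) (t := t + 3)
    ltac:(lia).
  have f := II t (t + 1) (t + 2) (t + 3) ltac:(lia).
  rewrite (_ : t == t + 3 = false) ?mul0r in f; last lia.
  rewrite !ht' in f0 f1; [|lia..].
  rewrite !wtD !subr0 in n1 n2 n3 e0 e1 e2 f0 f1.
  set X := wt a t in n1 n2 n3 e0 e1 e2 f0 f1.
  have g0 : J t (t + 2) = J t (t + 1) * (X + 1) - X * J (t + 1) (t + 2).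
    by apply: (lincomb1 (k1 := -1) f0); ring.
  have g1 : J (t + 1) (t + 3) = J (t + 1) (t + 2) * (X + 2) - (X + 1) * J
    (t + 2) (t + 3).
    by apply: (lincomb1 (k1 := -1) f1); ring.
  have j0 : J t (t + 1) = k + de / (X + 1).
    by apply: (mulIf n1); rewrite e0; field.
  have j1 : J (t + 1) (t + 2) = k + de / (X + 1 + 1).
    by apply: (mulIf n2); rewrite e1; field.
  have j2 : J (t + 2) (t + 3) = k + de / (X + 2 + 1).
    by apply: (mulIf n3); rewrite e2; field.
  rewrite g0 g1 j0 j1 j2 in f.
  apply: (mulfI (natS_neq0 F 1)).
  apply: (lincomb1 (k1 := (X + 1) * (X + 1 + 1) * (X + 2 + 1)) f).
  by field; rewrite n1 n2 n3.
rewrite mulf_eq0 => /orP[]/eqP d0.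
  have g := good d0 ltac:(by rewrite dd d0 oppr0).
  split=> //; last by exists T0; left.
  by apply: (eta0 T0) => t /g[-> ->].
have {}d0 : de = - k by apply/eqP; rewrite -addr_eq0 addrC d0.
have g t : T0 <= t -> J t (t + 1) * wt a (t + 1) = k * wt a t
   /\ J (t + 1) t * wt a t = k * wt a (t + 1).
  move=> /nz[tT _ _ _]; have e1 := up t tT; have e2 := down t tT.
  rewrite dd d0 in e1 e2; rewrite wtD; split.
    by apply: (lincomb1 (k1 := 1) e1); ring.
  by apply: (lincomb1 (k1 := 1) e2); ring.
split=> //; last by exists T0; right.
apply: (eta0 T0) => t tT; have [g1 g2] := g t tT.
have [_ n0 _ _] := nz t tT; have [_ n1 _ _] := nz (t + 1) ltac:(lia).
apply: (mulIf n0); apply: (mulIf n1).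
by apply: (lincomb2 (k1 := J (t + 1) t * wt a t) (k2 := k * wt a t) g1 g2);
  ring.
Qed.

Lemma tail_const_up a b k E J T : (forall t, J t t = k) -> li_rel a 0 E J ->
  tail_dens a b E T -> (forall t, T <= t -> J t (t + 1) = k) ->
  forall (n : nat) t, T <= t -> J t (t + n%:Z) = k.
Proof.
move=> J0 LI ht h; elim=> [|[|n] IH] t tT; first by rewrite addr0.
  exact: h.
have e := li0 LI (s := t) (r := t + n.+1%:Z) (r' := t + 1) (t := t + n.+2%:Z)
  ltac:(lia).
rewrite !ht ?IH in e; [|lia..].
have e1 := h (t + n.+1%:Z) ltac:(lia).
have e2 := IH (t + 1) ltac:(lia).
rewrite (_ : t + 1 + n.+1%:Z = t + n.+2%:Z) in e2; last lia.
rewrite e2 /dens !wtD in e.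
apply: (mulfI (natS_neq0 F n)).
by apply: (lincomb1 (k1 := -1) e); ring.
Qed.

Lemma tail_const_all a b k E J T : (forall t, J t t = k) -> li_rel a 0 E J ->
  tail_dens a b E T ->
  (forall t, T <= t -> J t (t + 1) = k /\ J (t + 1) t = k) ->
  forall r t, T <= r -> T <= t -> J r t = k.
Proof.
move=> J0 LI ht h r t rT tT; have [rt|tr] := lerP r t.
  have := tail_const_up J0 LI ht (fun t tT => proj1 (h t tT)) `|t - r|%N rT.
  by rewrite (_ : r + _ = t) //; lia.
have := tail_const_up J0 (li_transp LI) (tail_transp ht)
   (fun t tT => proj2 (h t tT)) `|r - t|%N tT.
by rewrite (_ : t + _ = r) //; lia.
Qed.


(** Applied to the defect [J w y - k] with [A = 1 - b] and [B = b]. If [B] is nonzero, the sources y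
    and y + 1 express [e z] by two affine functions of [wt a z], and their comparison gives e y = 0.
    If [B = 0], [e] is eventually constant and the nonzero weight of w kills it. *)
Lemma slope_zero a (A B : F) w T (e : int -> F) : A + B = 1 -> A != 0 ->
  (B != 0) || (wt a w != 0) ->
  (forall y y' z, T <= y -> T <= y' -> T <= z -> y + y' = w + z ->
     e y * (A * wt a y + B * wt a z) = (wt a y - wt a w) * e z) ->
  exists M, forall y, M <= y -> e y = 0.
Proof.
move=> AB A0 hB h; pose M : int := `|T| + `|w| + 1.
have nw y : M <= y -> wt a y - wt a w != 0.
  by move=> yM; rewrite subr_eq0 (inj_eq (@wt_inj _ a)); lia.
have rel y z : M <= y -> y + M <= z ->
    e y * (A * wt a y + B * wt a z) = (wt a y - wt a w) * e z.
  by move=> yM zM; apply: (h y (w + z - y)); lia.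
have [B0|B0] := eqVneq B 0.
  have w0 : wt a w != 0 by move: hB; rewrite B0 eqxx.
  have A1 : A = 1 by rewrite -AB B0 addr0.
  rewrite {}B0 {}A1 in rel.
  have [eps he] : exists eps, forall z, 2 * M <= z -> e z = eps.
    exists (e M * wt a M / (wt a M - wt a w)) => z zM.
    apply: (mulfI (nw M ltac:(lia))).
    by rewrite -rel; [field; apply: nw | |]; lia.
  suff eps0 : eps = 0 by exists (2 * M) => y /he ->.
  have := rel (2 * M) (3 * M) ltac:(lia) ltac:(lia).
  rewrite !he; [|lia..] => e1; apply: (mulfI w0).
  by apply: (lincomb1 (k1 := 1) e1); ring.
exists M => y yM; pose q := e y * (wt a (y + 1) - wt a w).
pose q' := e (y + 1) * (wt a y - wt a w).
have R z : y + 1 + M <= z -> q * (A * wt a y + B * wt a z)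
    = q' * (A * wt a (y + 1) + B * wt a z).
  move=> zM; have e1 := rel y z yM ltac:(lia).
  have e2 := rel (y + 1) z ltac:(lia) zM.
  apply: (lincomb2 (k1 := wt a (y + 1) - wt a w) (k2 := - (wt a y - wt a w)) e1
    e2).
  by rewrite /q /q'; ring.
have R0 := R (y + 1 + M) ltac:(lia); have R1 := R (y + 1 + M + 1) ltac:(lia).
have qq : q = q'.
  apply: (mulfI B0).
  by apply: (lincomb2 (k1 := 1) (k2 := -1) R1 R0); rewrite !wtD; ring.
have /eqP : q = 0.
  apply: (mulfI A0); rewrite -qq in R0.
  by apply: (lincomb1 (k1 := -1) R0); rewrite !wtD; ring.
by rewrite mulf_eq0 (negPf (nw (y + 1) _)) ?orbF; [move/eqP | lia].
Qed.

Lemma heis_const_out a b k E J T w : b != 1 ->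
  (forall t, T <= t -> wt a t != 0) ->
  (forall t, J t t = k) -> li_rel a 0 E J ->
  (forall r t, T <= r -> T <= t -> J r t = k) -> tail_dens a b E T ->
  (forall y, T <= y -> E w y = dens b (wt a w) (wt a y)) ->
  (b != 0) || (wt a w != 0) ->
  forall y, T <= y -> J w y = k.
Proof.
move=> b1 nz J0 LI Jk ht Ew w0 y yT.
pose e y := J w y - k; suff : e y = 0 by move/subr0_eq.
have rel u u' z : T <= u -> T <= u' -> T <= z -> u + u' = w + z ->
    e u * ((1 - b) * wt a u + b * wt a z) = (wt a u - wt a w) * e z.
  move=> uT uT' zT uz; have := li0 LI uz.
  rewrite Ew // (ht u) // (Jk u') // (wt_add a uz) => h.
  by apply: (lincomb1 (k1 := 1) h); rewrite /e /dens; ring.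
have AB : (1 - b) + b = 1 by ring.
have A0 : 1 - b != 0 by rewrite subr_eq0 eq_sym.
have [M hM] := slope_zero AB A0 w0 rel.
have [|z zM dz] := @dens_neq0_large F a b (wt a y) (`|M| + `|T| + `|w| + `|y|).
  by rewrite nz ?orbT.
have := rel y (w + z - y) z yT ltac:(lia) ltac:(lia) ltac:(lia).
rewrite (hM z) ?mulr0; last lia.
have -> : (1 - b) * wt a y + b * wt a z = dens b (wt a y) (wt a z).
  by rewrite /dens; ring.
by move/eqP; rewrite mulf_eq0 (negPf dz) orbF => /eqP.
Qed.

Lemma heis_const a b k E J T : b != 1 ->
  (forall t, J t t = k) -> li_rel a 0 E J ->
  (forall t, T <= t -> J t (t + 1) = k /\ J (t + 1) t = k) ->
  (forall r t, (b != 0) || (wt a r != 0) -> (b != 0) || (wt a t != 0) ->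
     E r t = dens b (wt a r) (wt a t)) ->
  forall r t, (b != 0) || (wt a r != 0) -> (b != 0) || (wt a t != 0) ->
    J r t = k.
Proof.
move=> b1 J0 LI Jk hE r t Nr Nt.
have [T0 nz] := eventually_wt_neq a 0.
pose T' : int := Num.max T T0.
have {}nz u : T' <= u -> wt a u != 0 by move=> uT; apply: nz; lia.
have Nu u : T' <= u -> (b != 0) || (wt a u != 0) by move/nz => ->; rewrite orbT.
have ht : tail_dens a b E T' by move=> u v uT vT; apply: hE; apply: Nu.
have Jk' : forall u v, T' <= u -> T' <= v -> J u v = k.
  by apply: tail_const_all J0 LI ht _ => u uT; apply: Jk; lia.
have out u : (b != 0) || (wt a u != 0) -> forall y, T' <= y -> J u y = k.
  move=> N0.
  have Ew y : T' <= y -> E u y = dens b (wt a u) (wt a y).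
    by move=> /Nu; apply: hE.
  exact: heis_const_out b1 nz J0 LI Jk' ht Ew N0.
have [z zM dz] := dens_neq0_large a (`|T'| + `|r| + `|t|) Nt.
have := li0 LI (s := r) (r := t) (r' := r + z - t) (t := z) ltac:(lia).
have Nz : (b != 0) || (wt a z != 0) by apply: Nu; lia.
have Ny : (b != 0) || (wt a (r + z - t) != 0) by apply: Nu; lia.
rewrite (hE t z) // (hE r _ Nr Ny) (out r Nr z) ?(Jk' _ z); [|lia..].
move=> e; apply: (mulIf dz).
have X : wt a (r + z - t) = wt a r + wt a z - wt a t by apply: wt_add; lia.
by apply: (lincomb1 (k1 := 1) e); rewrite /dens X; ring.
Qed.

End HeisVir.

(** * The vertex of weight zero *)

Section ZeroWeight.
Variable F : numClosedFieldType.
Implicit Types (a b zet eta k : F) (E J : int -> int -> F) (r s t T w : int).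

(** Affine functions solve the relation, and [g 1], [g 2] determine the rest. As 0 is excluded, the
    negative side is entered through -1 + 2 = 1. *)
Lemma int_linear (g : int -> F) :
  (forall n m : int, n != 0 -> m != 0 -> n + m != 0 ->
     n%:~R * g n - m%:~R * g m = (n - m)%:~R * g (n + m)) ->
  exists al be, forall n : int, n != 0 -> g n = al * n%:~R + be.
Proof.
move=> gE; pose al := g 2 - g 1; pose be := 2 * g 1 - g 2; exists al, be.
pose h n := g n - (al * n%:~R + be).
have hE n m : n != 0 -> m != 0 -> n + m != 0 ->
    n%:~R * h n - m%:~R * h m = (n - m)%:~R * h (n + m).
  by move=> n0 m0 nm; apply: (lincomb1 (k1 := 1) (gE n m n0 m0 nm));
    rewrite /h; ring.
have h1 : h 1 = 0 by rewrite /h /al /be; ring.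
have h2 : h 2 = 0 by rewrite /h /al /be; ring.
have hN1 : h (-1) = 0.
  have := hE (-1) 2 isT isT isT; rewrite h2 (_ : -1 + 2 = 1) // h1 => e.
  by apply: (lincomb1 (k1 := -1) e); ring.
have hpos (n : nat) : h n.+1%:Z = 0 /\ h n.+2%:Z = 0.
  elim: n => // n [IH1 IH2]; split=> //; apply: (mulfI (natS_neq0 F n)).
  have := hE n.+2%:Z 1 isT isT isT; rewrite IH2 h1 (_ : n.+2%:Z + 1 = n.+3%:Z);
    last lia.
  by move=> e; apply: (lincomb1 (k1 := -1) e); ring.
have hneg (n : nat) : h (- n.+1%:Z) = 0.
  elim: n => // n IH; apply: (mulfI (natS_neq0 F n.+1)).
  have := hE (- n.+2%:Z) 1 isT isT ltac:(lia).
  rewrite h1 (_ : - n.+2%:Z + 1 = - n.+1%:Z) ?IH; last lia.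
  by move=> e; apply: (lincomb1 (k1 := -1) e); ring.
move=> n n0; apply/subr0_eq; rewrite -/(h n).
case: n n0 => [[//|n] _|n _]; first by case: (hpos n).
by rewrite NegzE.
Qed.

Lemma wt0 t : wt (0 : F) t = t%:~R.
Proof. by rewrite /wt add0r. Qed.

(* The nonzero weights carry the functions module with I(n) = k; for k <> 0
   the action of I forces the zero weight vector to complete it. *)
Lemma functions_complete k E J : k != 0 ->
  witt_rel 0 E -> heis_rel 0 0 0 k E J ->
  (forall r t, r != 0 -> t != 0 -> E r t = r%:~R) ->
  (forall r t, r != 0 -> t != 0 -> J r t = k) ->
  exists2 c, forall t : int, c t != 0 &
    forall r t, gauge c E r t = r%:~R /\ gauge c J r t = k.
Proof.
move=> k0 [E0 LL] [J0 LI II] hE hJ.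
(* Here and in [zero_weight_classified], [d] and [D] name the coefficients of L and I into the
   vertex 0, [u] and [U] those out of it. *)
have dU x z : x != 0 -> z != 0 -> x + z != 0 -> E x 0 * J 0 z = k * x%:~R.
  move=> x0 z0 xz;
    have := li0 LI (s := x) (r := x + z) (r' := 0) (t := z) ltac:(lia).
  rewrite (hE (x + z) z) // (hJ x (x + z)) // (hJ x z) // !wt0 => e.
  by apply: (lincomb1 (k1 := -1) e); ring.
pose c0 := J 0 1.
have U z : z != 0 -> J 0 z = c0 /\ c0 != 0.
  move=> z0; pose x : int := `|z| + 1.
  have e1 := dU x z ltac:(lia) z0 ltac:(lia).
  have e2 := dU x 1 ltac:(lia) isT ltac:(lia).
  have kx : k * x%:~R != 0 by rewrite mulf_neq0 // intr_eq0; lia.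
  have dx : E x 0 != 0.
    by apply: contra_neq kx => dx; rewrite -e2 dx mul0r.
  split; first by apply: (mulfI dx); rewrite e1 e2.
  by apply: contra_neq kx => cz; rewrite -e2 -/c0 cz mulr0.
have [_ c00] := U 1 isT.
have other x : x != 0 -> exists z : int, [/\ z != 0, x + z != 0 & J 0 z = c0].
  move=> x0; exists (`|x| + 1); split; [lia | lia |].
  by have [] := U (`|x| + 1) ltac:(lia).
have d x : x != 0 -> E x 0 = k / c0 * x%:~R.
  move=> x0; have [z [z0 xz Uz]] := other x x0.
  have := dU x z x0 z0 xz; rewrite Uz => e; apply: (mulIf c00).
  by rewrite e; field.
have D x : x != 0 -> J x 0 = k / c0 * k.
  move=> x0; have [z [z0 xz Uz]] := other x x0.
  have := ii0 II (s := x) (r := 0) (r' := x + z) (t := z) ltac:(lia).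
  rewrite Uz (hJ x (x + z)) // (hJ (x + z) z) // => e; apply: (mulIf c00).
  by rewrite e; field.
have u z : z != 0 -> E 0 z = 0.
  move=> z0; pose x : int := `|z| + 1.
  have := li0 LI (s := x) (r := 0) (r' := x + z) (t := z) ltac:(lia).
  rewrite D ?(hE x) ?(hJ _ z) ?wt0; [|lia..] => e.
  apply: (mulfI (mulf_neq0 (mulf_neq0 k0 (invr_neq0 c00)) k0)).
  by apply: (lincomb1 (k1 := 1) e); ring.
exists (fun t => if t == 0 then k / c0 else 1).
  by move=> t; case: ifP => _; rewrite ?oner_neq0 // mulf_neq0 ?invr_eq0.
move=> r t; rewrite /gauge.
have [->|r0] := eqVneq r 0; have [->|t0] := eqVneq t 0.
- by rewrite E0 J0 wt0 mulr0; split=> //; field; rewrite k0 c00.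
- by rewrite u // mulr0; have [-> _] := U t t0; split=> //; field.
- by rewrite d // D //; split; field; rewrite k0 c00.
by rewrite hE // hJ // divr1 !mul1r.
Qed.

(** The isomorphism sends v_t to [(c t)^-1] times the basis vector t + [sh]; the shift lets the
    vertex of weight 0 sit at any index. *)
Definition hv_model (lc ic : int -> int -> F) E J :=
  exists c sh, (forall t : int, c t != 0) /\ forall r t,
    gauge c E r t = lc (t - r) (r + sh) /\ gauge c J r t = ic (t - r) (r + sh).

Definition hv_classified E J : Prop :=
  (exists a b c, hv_model
    (fun n t => a + t%:~R + b * n%:~R) (fun _ _ => c) E J) \/
  (exists a d, hv_model
    (fun n t => if t == 0 then n%:~R * (n%:~R + a) else (t + n)%:~R)
    (fun n t => if t == 0 then d * n%:~R else 0) E J) \/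
  (exists a d, hv_model
    (fun n t => if n + t == 0 then - n%:~R * (n%:~R + a) else t%:~R)
    (fun n t => if n + t == 0 then d * n%:~R else 0) E J) \/
  (exists d, hv_model (fun n t => t%:~R)
    (fun n t => if n + t == 0 then n%:~R * d else 0) E J) \/
  (exists d, hv_model (fun n t => (t + n)%:~R)
    (fun n t => if t == 0 then n%:~R * d else 0) E J) \/
  (exists d, d != 0 /\ hv_model
    (fun n t => if n + t == 0 then 0 else t%:~R)
    (fun n t => if n + t == 0 then d * n%:~R else 0) E J) \/
  (exists c, c != 0 /\ hv_model
    (fun n t => if n + t == 0 then 0 else t%:~R)
    (fun n t => if t == 0 then if n == 0 then 0 else c else 0) E J).

(** A path x, 0, z has product zero when x, z and x + z are nonzero. So if L leads out of 0, nothing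
    leads in, which gives A(a, d) and V_d; if L leads into 0, nothing leads out, which gives B(a, d)
    and U_d; otherwise I alone attaches 0, which gives the two families with a tilde. *)
Lemma zero_weight_classified E J :
  witt_rel 0 E -> heis_rel 0 0 0 0 E J ->
  (forall r t, r != 0 -> t != 0 -> E r t = r%:~R) ->
  (forall r t, r != 0 -> t != 0 -> J r t = 0) ->
  ~ (forall t, t != 0 -> [/\ E 0 t = 0, E t 0 = 0, J 0 t = 0 & J t 0 = 0]) ->
  hv_classified E J.
Proof.
move=> [E0 LL] [J0 LI II] hE hJ indec.
have ir0 (n : int) : n != 0 -> n%:~R != 0 :> F by rewrite intr_eq0.
have dU x z : x != 0 -> z != 0 -> x + z != 0 -> E x 0 * J 0 z = 0.
  move=> x0 z0 xz;
    have := li0 LI (s := x) (r := x + z) (r' := 0) (t := z) ltac:(lia).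
  rewrite (hE (x + z) z) // (hJ x (x + z)) // (hJ x z) // => e.
  by apply: (lincomb1 (k1 := -1) e); ring.
have Du x z : x != 0 -> z != 0 -> x + z != 0 -> J x 0 * E 0 z = 0.
  move=> x0 z0 xz;
    have := li0 LI (s := x) (r := 0) (r' := x + z) (t := z) ltac:(lia).
  rewrite (hJ (x + z) z) // (hJ x z) // => e.
  by apply: (lincomb1 (k1 := 1) e); ring.
have DU x z : x != 0 -> z != 0 -> x + z != 0 -> J x 0 * J 0 z = 0.
  move=> x0 z0 xz;
    have := ii0 II (s := x) (r := 0) (r' := x + z) (t := z) ltac:(lia).
  by rewrite (hJ (x + z) z) // mulr0.
have du x z : x != 0 -> z != 0 -> x + z != 0 -> E x 0 * E 0 z = 0.
  move=> x0 z0 xz; have := LL x 0 (x + z) z ltac:(lia).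
  rewrite (hE x (x + z)) // (hE (x + z) z) // (hE x z) // !wt0 => e.
  by apply: (lincomb1 (k1 := 1) e); ring.
pose c0 := J 0 1.
have U z : z != 0 -> J 0 z = c0.
  move=> z0; have [->//|z1] := eqVneq z 1.
  have := li0 LI (s := 0) (r := 1) (r' := z - 1) (t := z) ltac:(lia).
  rewrite (hE 1 z) // (hJ (z - 1) z) ?wt0; [|lia|lia] => e.
  by apply: (lincomb1 (k1 := -1) e); rewrite /c0; ring.
pose eps := J 1 0.
have D y : y != 0 -> J y 0 = eps * y%:~R.
  move=> y0; have [->|y1] := eqVneq y 1; first by rewrite /eps; ring.
  have := li0 LI (s := y) (r := y - 1) (r' := 1) (t := 0) ltac:(lia).
  rewrite (hJ y (y - 1)) ?(hE y 1) ?wt0; [|lia..] => e.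
  by apply: (lincomb1 (k1 := 1) e); rewrite /eps; ring.
have [al [be u]] : exists al be, forall z, z != 0 -> E 0 z = al * z%:~R + be.
  apply: (@int_linear (E 0)) => n m n0 m0 nm.
  have := LL 0 n m (n + m) ltac:(lia).
  rewrite (hE n) // (hE m) // !wt0 => e.
  by apply: (lincomb1 (k1 := 1) e); ring.
have [al' [be' d]] : exists al be, forall z, z != 0 ->
    E z 0 = z%:~R * (al * z%:~R + be).
  have [|al' [be' d]] := @int_linear (fun z => E z 0 / z%:~R).
    move=> n m n0 m0 nm; have := LL (n + m) n m 0 ltac:(lia).
    rewrite (hE _ n) // (hE _ m) // !wt0 => e.
    have cK i : i != 0 -> i%:~R * (E i 0 / i%:~R) = E i 0.
      by move=> i0; rewrite mulrC divfK // ir0.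
    rewrite !cK //; apply: (mulfI (ir0 _ nm)).
    by rewrite mulrBr e mulrCA cK // -intrB.
  by exists al', be' => z z0; rewrite -d // mulrC divfK // ir0.
have lin_eq0 (A B : F) (z : int) :
    (forall x : int, x != 0 -> x + z != 0 -> A * x%:~R + B = 0) -> A = 0 /\
      B = 0.
  move=> h; pose x : int := `|z| + 1.
  have e1 := h x ltac:(lia) ltac:(lia);
    have e2 := h (x + 1) ltac:(lia) ltac:(lia).
  have A0 : A = 0.
    by apply: (lincomb2 (k1 := 1) (k2 := -1) e2 e1); ring.
  by split=> //; move: e1; rewrite A0 mul0r add0r.
have model_intro lc ic (c : int -> F) : (forall t : int, c t != 0) ->
    (forall r t, c r * E r t = lc (t - r) r * c t /\
      c r * J r t = ic (t - r) r * c t) ->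
    hv_model lc ic E J.
  move=> cn0 h; exists c, 0; split=> // r t; have [h1 h2] := h r t.
  rewrite addr0; split; apply: (mulIf (cn0 t)).
    by rewrite -h1 /gauge; field.
  by rewrite -h2 /gauge; field.
have [[z [z0 uz]]|u0] := EM (exists z, z != 0 /\ E 0 z <> 0).
  move/eqP in uz.
  have [al0' be0'] : al' = 0 /\ be' = 0.
    apply: (lin_eq0 _ _ z) => x x0 xz; apply: (mulfI (ir0 x x0)).
    by rewrite -d // mulr0; apply: (mulIf uz); rewrite mul0r du.
  have eps0 : eps = 0.
    pose x : int := `|z| + 1; have x0 : x != 0 by lia.
    apply: (mulIf (ir0 x x0)); rewrite -D // mul0r.
    by apply: (mulIf uz); rewrite mul0r Du //; lia.
  have {}d x : x != 0 -> E x 0 = 0.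
    by move=> x0; rewrite d // al0' be0'; ring.
  have {}D x : x != 0 -> J x 0 = 0 by move=> x0; rewrite D // eps0 mul0r.
  (* The models with arrows out of 0 have L-coefficient t on arrows r to t between nonzero vertices,
     the form b = 1; hence the factor t^-1. *)
  pose c (g : F) (t : int) := if t == 0 then g else t%:~R^-1.
  have c_neq0 g : g != 0 -> forall t, c g t != 0.
    by move=> g0 t; rewrite /c; have [_|t0] := eqVneq t 0;
      rewrite ?invr_eq0 ?ir0.
  have [al0|al0] := eqVneq al 0.
    have be0 : be != 0 by move: uz; rewrite u // al0 mul0r add0r.
    do 4!right; left; exists (c0 / be).
    apply: (model_intro _ _ (c be^-1)); first by apply: c_neq0;
      rewrite invr_eq0.
    move=> r t; rewrite /c.
    have [->|r0] := eqVneq r 0; have [->|t0] := eqVneq t 0.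
    - by rewrite E0 J0 wt0; split; ring.
    - rewrite u // U // al0 add0r subr0.
      by split; field; rewrite be0 (ir0 t t0).
    - by rewrite d // D // addrC subrK; split; ring.
    by rewrite hE // hJ // addrC subrK; split; [field; rewrite !ir0 | ring].
  right; left; exists (be / al), (c0 / al).
  apply: (model_intro _ _ (c al^-1)); first by apply: c_neq0; rewrite invr_eq0.
  move=> r t; rewrite /c.
  have [->|r0] := eqVneq r 0; have [->|t0] := eqVneq t 0.
  - by rewrite E0 J0 wt0; split; ring.
  - rewrite u // U // subr0.
    by split; field; rewrite al0 (ir0 t t0).
  - by rewrite d // D // addrC subrK; split; ring.
  by rewrite hE // hJ // addrC subrK; split; [field; rewrite !ir0 | ring].
have {}u0 z : z != 0 -> E 0 z = 0.
  by move=> z0; apply/eqP; apply: contraT => /eqP uz; case: u0; exists z.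
pose c (g : F) (t : int) := if t == 0 then g else 1.
have c_neq0 g : g != 0 -> forall t, c g t != 0.
  by move=> g0 t; rewrite /c; case: ifP => _; rewrite ?oner_neq0.
have [[x [x0 dx]]|d0] := EM (exists x, x != 0 /\ E x 0 <> 0).
  move/eqP in dx.
  have c00 : c0 = 0.
    pose z : int := `|x| + 1.
    have z0 : z != 0 by lia.
    by apply: (mulfI dx); rewrite mulr0 -(U z z0) dU //; lia.
  have {}U z : z != 0 -> J 0 z = 0 by move=> z0; rewrite U.
  have [al0|al0] := eqVneq al' 0.
    have be0 : be' != 0.
      by apply: contra_neq dx => be0; rewrite d // al0 be0; ring.
    do 3!right; left; exists (- eps / be').
    apply: (model_intro _ _ (c be')); first exact: c_neq0.
    move=> r t; rewrite subrK /c.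
    have [->|r0] := eqVneq r 0; have [->|t0] := eqVneq t 0.
    - by rewrite E0 J0 wt0; split; ring.
    - by rewrite u0 // U //; split; ring.
    - by rewrite d // D // al0; split; [ring | field].
    by rewrite hE // hJ //; split; ring.
  (* The arrow from r to 0 belongs to n = - r, whence the signs. *)
  do 2!right; left; exists (- be' / al'), (eps / al').
  apply: (model_intro _ _ (c (- al'))); first by apply: c_neq0;
    rewrite oppr_eq0.
  move=> r t; rewrite subrK /c.
  have [->|r0] := eqVneq r 0; have [->|t0] := eqVneq t 0.
  - by rewrite E0 J0 wt0; split; ring.
  - by rewrite u0 // U //; split; ring.
  - by rewrite d // D //; split; field.
  by rewrite hE // hJ //; split; ring.
have {}d0 z : z != 0 -> E z 0 = 0.
  by move=> z0; apply/eqP; apply: contraT => /eqP dz; case: d0; exists z.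
have [c00|c00] := eqVneq c0 0.
  have eps0 : eps != 0.
    apply/eqP => eps0; apply: indec => t t0.
    by rewrite u0 // d0 // U // D // eps0 mul0r c00.
  do 5!right; left; exists (- eps); split; first by rewrite oppr_eq0.
  apply: (model_intro _ _ (fun=> 1)) => [_|r t]; first exact: oner_neq0.
  rewrite subrK; have [->|r0] := eqVneq r 0; have [->|t0] := eqVneq t 0.
  - by rewrite E0 J0 wt0; split; ring.
  - by rewrite u0 // U // c00; split; ring.
  - by rewrite d0 // D //; split; ring.
  by rewrite hE // hJ //; split; ring.
have eps0 : eps = 0.
  by apply: (mulIf c00); rewrite mul0r -[c0](U 1) // -[eps]mulr1 -(D 1) // DU.
do 6!right; exists c0; split=> //.
apply: (model_intro _ _ (fun=> 1)) => [_|r t]; first exact: oner_neq0.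
rewrite subrK; have [->|r0] := eqVneq r 0; have [->|t0] := eqVneq t 0.
- by rewrite E0 J0 wt0 subrr eqxx; split; ring.
- by rewrite u0 // U // subr0 (negPf t0); split; ring.
- by rewrite d0 // D // eps0; split; ring.
by rewrite hE // hJ //; split; ring.
Qed.

End ZeroWeight.

(** * Assembling the classification of coefficient matrices *)

Section Classification.
Variable F : numClosedFieldType.
Implicit Types (a b zet eta k : F) (E J : int -> int -> F) (r s t T w : int).

Definition shift_by (o : int) E r t : F := E (r + o) (t + o).

Lemma wt_shift a (o : int) r : wt (wt a o) r = wt a (r + o).
Proof. by rewrite /wt; ring. Qed.

Lemma witt_shift a o E : witt_rel a E -> witt_rel (wt a o) (shift_by o E).
Proof.
case=> E0 LL; split=> [t|s r r' t e]; first by rewrite /shift_by E0 wt_shift.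
by rewrite !wt_shift; apply: LL; lia.
Qed.

Lemma heis_shift a o zet eta k E J : heis_rel a zet eta k E J ->
  heis_rel (wt a o) zet eta k (shift_by o E) (shift_by o J).
Proof.
have eqo s t : (s == t) = (s + o == t + o) by rewrite (inj_eq (addIr o)).
case=> J0 LI II; split=> [t|s r r' t e|s r r' t e]; first exact: J0.
  by rewrite !wt_shift eqo; apply: LI; lia.
by rewrite !wt_shift eqo; apply: II; lia.
Qed.

Lemma hv_model_gauge lc ic E J (c : int -> F) : (forall t, c t != 0) ->
  hv_model lc ic (gauge c E) (gauge c J) -> hv_model lc ic E J.
Proof.
move=> c0 [d [sh [d0 h]]]; exists (fun t => d t * c t), sh.
split=> [t|r t]; first by rewrite mulf_neq0.
by rewrite -!gauge_comp.
Qed.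

Lemma hv_model_shift lc ic E J o :
  hv_model lc ic (shift_by o E) (shift_by o J) -> hv_model lc ic E J.
Proof.
move=> [d [sh [d0 h]]]; exists (fun t => d (t - o)), (sh - o).
split=> [t|r t]; first exact: d0.
have := h (r - o) (t - o); rewrite /shift_by /gauge !subrK.
have -> : t - o - (r - o) = t - r by ring.
by have -> : r - o + sh = r + (sh - o) by ring.
Qed.

Lemma hv_classified_imp E J E' J' :
  (forall lc ic, hv_model lc ic E J -> hv_model lc ic E' J') ->
  hv_classified E J -> hv_classified E' J'.
Proof.
move=> h [[x [y [z H]]]|]; first by left; exists x, y, z; apply: h.
case=> [[x [y H]]|]; first by right; left; exists x, y; apply: h.
case=> [[x [y H]]|]; first by do 2!right; left; exists x, y; apply: h.
case=> [[x H]|]; first by do 3!right; left; exists x; apply: h.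
case=> [[x H]|]; first by do 4!right; left; exists x; apply: h.
case=> [[x [x0 H]]|[x [x0 H]]]; first by do 5!right; left; exists x;
  split=> //; apply: h.
by do 6!right; exists x; split=> //; apply: h.
Qed.

Lemma functions_normal a k E J T : witt_rel a E -> heis_rel a 0 0 k E J ->
  (forall r t, wt a r != 0 -> wt a t != 0 -> E r t = wt a r) ->
  (forall t, T <= t -> J t (t + 1) = k /\ J (t + 1) t = k) ->
  (k != 0 \/ forall t, wt a t != 0) ->
  exists2 c, forall t : int, c t != 0 &
    forall r t, gauge c E r t = wt a r /\ gauge c J r t = k.
Proof.
move=> hE hJ En Jt kwt.
have [J0 LI _] := hJ.
have Jn r t : wt a r != 0 -> wt a t != 0 -> J r t = k.
  move=> r0 t0; apply: (@heis_const F a 0 k E J T) => //.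
  - by rewrite eq_sym oner_neq0.
  - by rewrite eqxx /= => r' t' r0' t0'; rewrite En // /dens mul0r addr0.
  - by rewrite eqxx.
  by rewrite eqxx.
have [all0|/existsNP[o /negP]] := EM (forall t, wt a t != 0).
  exists (fun=> 1) => [_|r t]; first exact: oner_neq0.
  by rewrite /gauge divff ?oner_neq0 // !mul1r En ?Jn ?all0.
rewrite negbK => /eqP o0; have {kwt} k0 : k != 0.
  by case: kwt => // /(_ o); rewrite o0 eqxx.
have nz r : r != 0 -> wt a (r + o) != 0.
  by move=> r0; rewrite -o0 (inj_eq (@wt_inj _ a)); lia.
have hE' := witt_shift o hE; have hJ' := heis_shift o hJ.
rewrite o0 in hE' hJ'.
have [r t r0 t0|r t r0 t0|c c0 hc] := functions_complete k0 hE' hJ'.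
- by rewrite /shift_by En ?nz // -wt_shift o0 wt0.
- by rewrite /shift_by Jn ?nz.
exists (fun t => c (t - o)) => [t|r t]; first exact: c0.
have [e1 e2] := hc (r - o) (t - o).
rewrite /shift_by /gauge !subrK in e1 e2.
rewrite /gauge e1 e2; split=> //.
by rewrite -wt0 -o0 wt_shift subrK.
Qed.

(** Of indecomposability only the absence of an isolated vertex is retained; it decides the case of
    a vertex of weight 0 with b = 0 and k = 0. *)
Theorem hv_classification a kap zet eta k E J :
  vir_rel a kap E -> heis_rel a zet eta k E J ->
  (forall o, ~ (forall t, t != o ->
     [/\ E o t = 0, E t o = 0, J o t = 0 & J t o = 0])) ->
  [/\ kap = 0, zet = 0, eta = 0 & hv_classified E J].
Proof.
move=> hV hJ indec.
have [k0 [b b1 inv]] := vir_invariants hV.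
have hE : witt_rel a E.
  case: hV => E0 LL; split=> // s r r' t e.
  by rewrite (LL _ _ _ _ e) k0 !mulr0 addr0.
have [c c0 hc] := witt_normal_form hE b1 inv.
have {}indec o : ~ (forall t, t != o ->
     [/\ gauge c E o t = 0, gauge c E t o = 0, gauge c J o t = 0 & gauge c J t
       o = 0]).
  move=> h; apply: (indec o) => t /h.
  have z r u A : gauge c A r u = 0 -> A r u = 0.
    move/eqP; rewrite /gauge !mulf_eq0 invr_eq0.
    by rewrite (negPf (c0 r)) (negPf (c0 u)) => /eqP.
  by case=> /z -> /z -> /z -> /z ->.
have {}hJ := heis_gauge c0 hJ; have {}hE := witt_gauge c0 hE.
suff [zz ee cl] : [/\ zet = 0, eta = 0 & hv_classified (gauge c E) (gauge c J)].
  by split=> //; apply: hv_classified_imp cl => lc ic; apply: hv_model_gauge.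
move: (gauge c E) (gauge c J) hc hE hJ indec =>
  {hV inv c c0}E {}J hc hE hJ indec.
have [T0 hT0] := eventually_wt_neq a 0.
have Nz t : T0 <= t -> (b != 0) || (wt a t != 0) by move/hT0 => ->;
  rewrite orbT.
have ht : tail_dens a b E T0 by move=> r t rT tT; apply: hc; apply: Nz.
have [z0 e0 [T1 tailJ]] := heis_tail b1 ht hJ.
rewrite {}z0 {}e0 in hJ *; split=> //.
have [J0 LI _] := hJ.
have [bz|bn] := eqVneq b 0; last first.
  have {}tailJ t : T1 <= t -> J t (t + 1) = k /\ J (t + 1) t = k.
    by case: tailJ => [h /h //|[bz]]; rewrite bz eqxx in bn.
  left; exists a, b, k, (fun=> 1), 0; split=> [_|r t]; first exact: oner_neq0.
  rewrite /gauge divff ?oner_neq0 // !mul1r addr0.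
  rewrite hc ?bn // (heis_const b1 J0 LI tailJ hc) ?bn //.
  by split=> //; rewrite /dens /wt; ring.
rewrite bz in hc tailJ.
have {}hc r t : wt a r != 0 -> wt a t != 0 -> E r t = wt a r.
  by move=> r0 t0; rewrite hc ?r0 ?t0 ?orbT // /dens mul0r addr0.
have [kz|kn] := EM (k = 0 /\ exists o, wt a o = 0).
  case: kz => kz [o o0].
  (* For k = 0 both alternatives of [heis_tail] say that [J] vanishes on the edges of the tail. *)
  have {}tailJ t : Num.max T0 T1 <= t -> J t (t + 1) = k /\ J (t + 1) t = k.
    move=> tT; case: tailJ => [|[_]] /(_ t ltac:(lia)) //.
    rewrite kz !mul0r => -[/eqP + /eqP].
    rewrite !mulf_eq0 (negPf (hT0 t ltac:(lia)))
      (negPf (hT0 (t + 1) ltac:(lia))).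
    by rewrite !orbF => /eqP -> /eqP ->.
  have nz r : r != 0 -> wt a (r + o) != 0.
    by move=> r0; rewrite -o0 (inj_eq (@wt_inj _ a)); lia.
  have hE' := witt_shift o hE; have hJ' := heis_shift o hJ.
  rewrite o0 kz in hE' hJ'.
  apply: (hv_classified_imp (E := shift_by o E) (J := shift_by o J)).
    by move=> lc ic; apply: hv_model_shift.
  apply: zero_weight_classified hE' hJ' _ _ _ => [r t r0 t0|r t r0 t0|h].
  - by rewrite /shift_by hc ?nz // -wt_shift o0 wt0.
  - rewrite /shift_by -kz; apply: (@heis_const F a 0 k E J (Num.max T0 T1)) =>
    //;
      rewrite ?nz ?orbT // 1?eq_sym ?oner_neq0 //.
    by rewrite eqxx /= => r' t' r0' t0'; rewrite hc // /dens mul0r addr0.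
  apply: (indec o) => t to; have := h (t - o) ltac:(lia).
  by rewrite /shift_by add0r subrK.
have kwt : k != 0 \/ forall t, wt a t != 0.
  have [kz|] := eqVneq k 0; last by left.
  right=> t; apply/eqP => t0; apply: kn; split=> //; by exists t.
left; exists a.
case: tailJ => [tailJ|[_ tailJ]].
  have [c c0 hn] := functions_normal hE hJ hc tailJ kwt.
  exists 0, k, c, 0; split=> // r t; have [-> ->] := hn r t.
  by split=> //; rewrite /wt; ring.
(* This tail is the case b = 1 seen through a rescaling by the weights. Undoing it and transposing
   leads back to b = 0 with constant [J]; the value 1 at weight 0 is a placeholder. *)
pose g t := if wt a t == 0 then 1 else (wt a t)^-1.
have g0 t : g t != 0.
  by rewrite /g; have [_|t0] := eqVneq (wt a t) 0; rewrite ?oner_neq0 ?invr_eq0.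
have hE2 := witt_transp (witt_gauge g0 hE).
have hJ2 := heis_transp (heis_gauge g0 hJ).
have hc2 r t : wt a r != 0 -> wt a t != 0 ->
    transp (gauge g E) r t = wt a r.
  move=> r0 t0; rewrite /transp /gauge /g (negPf r0) (negPf t0) hc //.
  by field; rewrite r0 t0.
have tail2 t : Num.max T0 T1 <= t -> transp (gauge g J) t (t + 1) = k
    /\ transp (gauge g J) (t + 1) t = k.
  move=> tT; have n0 := hT0 t ltac:(lia); have n1 := hT0 (t + 1) ltac:(lia).
  have [e1 e2] := tailJ t ltac:(lia).
  rewrite /transp /gauge /g (negPf n0) (negPf n1) !invrK; split.
    by apply: (mulIf n1); rewrite -e2; field.
  by apply: (mulIf n0); rewrite -e1; field.
have [c c0 hn] := functions_normal hE2 hJ2 hc2 tail2 kwt.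
(* Undoing the transposition inverts the scalars [c]. *)
exists 1, k, (fun t => (c t)^-1 * g t), 0; split=> [t|r t].
  by rewrite mulf_neq0 ?invr_eq0.
have [e1 e2] := hn t r; rewrite /transp /gauge in e1 e2.
rewrite addr0 /gauge; split.
  transitivity (wt a t); last by rewrite /wt; ring.
  by rewrite -e1; field; rewrite !c0 g0.
by rewrite -[RHS]e2; field; rewrite !c0 g0.
Qed.

End Classification.

(** * From modules to coefficients *)

Section Basis.
Variables (F : fieldType) (K : choiceType) (V : lmodType F) (v : K -> V).
Hypothesis v_basis : is_basis v.

Lemma basis_coord_exists : exists2 basis_coord : V -> {malg F[K]},
  cancel basis_coord (lin_ext v) & cancel (lin_ext v) basis_coord.
Proof.
have /choice[basis_coord h] u : exists c : {malg F[K]}, u = lin_ext v c.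
  by case: (v_basis u) => c [e _]; exists c.
exists basis_coord => [u|c]; first by rewrite -h.
have [c' [_ uniq_c]] := v_basis (lin_ext v c).
exact: etrans (esym (uniq_c _ (h _))) (uniq_c c erefl).
Qed.

Definition basis_coord := s2val (cid2 basis_coord_exists).

Lemma basis_coordK : cancel basis_coord (lin_ext v).
Proof. exact: (s2valP (cid2 basis_coord_exists)). Qed.

Lemma lin_extK : cancel (lin_ext v) basis_coord.
Proof. exact: (s2valP' (cid2 basis_coord_exists)). Qed.

Lemma basis_coord_linear : linear basis_coord.
Proof.
move=> k u w; apply: (can_inj lin_extK).
by rewrite basis_coordK (lin_ext_linear v) !basis_coordK.
Qed.

HB.instance Definition _ :=
  GRing.isLinear.Build F V {malg F[K]} *:%R basis_coord basis_coord_linear.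

Lemma coord_basis t : basis_coord (v t) = << t >>.
Proof. by rewrite -[v t](lin_extU v) lin_extK. Qed.

Lemma basis_linear_eq (W : lmodType F) (f g : V -> W) : linear f -> linear g ->
  (forall t, f (v t) = g (v t)) -> f =1 g.
Proof.
move=> fl gl fg u; rewrite -(basis_coordK u).
apply: (malg_linear_eq (f := fun c => f (lin_ext v c))
  (g := fun c => g (lin_ext v c))).
- by move=> k x y; rewrite (lin_ext_linear v) fl.
- by move=> k x y; rewrite (lin_ext_linear v) gl.
by move=> t; rewrite !lin_extU.
Qed.

Lemma basis_neq0 t : v t != 0.
Proof.
apply/eqP => vt; have := coord_basis t; rewrite vt linear0.
move/(congr1 (fun c : {malg F[K]} => c@_t)); rewrite mcoeff0 mcoeffUU => /eqP.
by rewrite eq_sym oner_eq0.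
Qed.

Lemma scale_basis_inj t : injective ( *:%R^~ (v t)).
Proof.
move=> k k' /eqP; rewrite -subr_eq0 -scalerBl scaler_eq0 (negPf (basis_neq0 t)).
by rewrite orbF subr_eq0 => /eqP.
Qed.

End Basis.

Section Coefficients.
Variables (F : numClosedFieldType) (V : lmodType F).
Variables (rho : lie_module (heisvir F) V) (v : int -> V).
Hypothesis v_basis : is_basis v.

Lemma lie_actZ x k u : rho x (k *: u) = k *: rho x u.
Proof.
have r0 : rho x 0 = 0.
  have := lie_act_linearr rho x 1 0 0; rewrite !scale1r addr0 => /eqP.
  by rewrite -subr_eq subrr eq_sym => /eqP.
by rewrite -[k *: u]addr0 lie_act_linearr r0 addr0.
Qed.

Lemma hv_homog_gen g : hv_homog (hv_deg g) (<< g >> : heisvir F).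
Proof. by move=> h; rewrite msuppU oner_eq0 inE => /eqP ->. Qed.

Lemma coefficients_exist :
  (forall (m n : int) (x : heisvir F), hv_homog m x ->
     exists k : F, rho x (v n) = k *: v (m + n)) ->
  exists E J : int -> int -> F, exists kap eta zet : int -> F,
  [/\ forall s t, rho << Lgen (t - s) >> (v s) = E s t *: v t,
      forall s t, rho << Igen (t - s) >> (v s) = J s t *: v t,
      forall s, rho << CLgen >> (v s) = kap s *: v s,
      forall s, rho << CIgen >> (v s) = eta s *: v s
    & forall s, rho << CLIgen >> (v s) = zet s *: v s].
Proof.
move=> gr.
have gr' g s t : hv_deg g + s = t -> exists k, rho << g >> (v s) = k *: v t.
  by move=> <-; apply: gr; apply: hv_homog_gen.
have [E hE] := choice
  (fun st : int * int => gr' (Lgen (st.2 - st.1)) st.1 st.2 (subrK _ _)).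
have [J hJ] := choice
  (fun st : int * int => gr' (Igen (st.2 - st.1)) st.1 st.2 (subrK _ _)).
have [kap hk] := choice (fun s => gr' CLgen s s (add0r s)).
have [eta he] := choice (fun s => gr' CIgen s s (add0r s)).
have [zet hz] := choice (fun s => gr' CLIgen s s (add0r s)).
exists (fun s t => E (s, t)), (fun s t => J (s, t)), kap, eta, zet.
by split=> // s t; [apply: (hE (s, t)) | apply: (hJ (s, t))].
Qed.

Variables (E J : int -> int -> F) (kap eta zet : int -> F).
Hypothesis hE : forall s t, rho << Lgen (t - s) >> (v s) = E s t *: v t.
Hypothesis hJ : forall s t, rho << Igen (t - s) >> (v s) = J s t *: v t.
Hypothesis hkap : forall s, rho << CLgen >> (v s) = kap s *: v s.
Hypothesis heta : forall s, rho << CIgen >> (v s) = eta s *: v s.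
Hypothesis hzet : forall s, rho << CLIgen >> (v s) = zet s *: v s.

Lemma lie_actZl k (x : heisvir F) u : rho (k *: x) u = k *: rho x u.
Proof.
have r0 : rho 0 u = 0.
  have := lie_act_linearl rho u 1 0 0; rewrite !scale1r addr0 => /eqP.
  by rewrite -subr_eq subrr eq_sym => /eqP.
by rewrite -[k *: x]addr0 lie_act_linearl r0 addr0.
Qed.

Lemma lie_act_lin2 (a b : F) (x y : heisvir F) u :
  rho (a *: x + b *: y) u = a *: rho x u + b *: rho y u.
Proof. by rewrite lie_act_linearl lie_actZl. Qed.

Lemma act_bracket (x y : heisvir F) u :
  rho (hv_bracket x y) u = rho x (rho y u) - rho y (rho x u).
Proof. exact: (lie_act_bracket rho). Qed.

Lemma relLL s r r' t : r + r' = s + t ->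
  E s r * E r t - E s r' * E r' t = (r - r')%:~R * E s t
    + (s == t)%:R * (12^-1 * ((r' - s) ^+ 3 - (r' - s))%:~R * kap s).
Proof.
move=> e; have e1 := hE r t; have e2 := hE r' t.
rewrite (_ : t - r = r' - s) in e1; last lia.
rewrite (_ : t - r' = r - s) in e2; last lia.
have := act_bracket << Lgen (r' - s) >> << Lgen (r - s) >> (v s).
rewrite (hE s r) (hE s r') !lie_actZ e1 e2.
rewrite hv_bracketLL lie_act_lin2 hkap.
rewrite (_ : r' - s + (r - s) = t - s); last lia.
rewrite (hE s t) (_ : (t - s == 0) = (s == t)); last lia.
rewrite (_ : r - s - (r' - s) = r - r'); last ring.
case: eqP => [<-|_].
  rewrite !scalerA -scalerBl -scalerDl => /(scale_basis_inj v_basis) <-.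
  by ring.
by rewrite !mul0r scale0r !addr0 !scalerA -scalerBl =>
  /(scale_basis_inj v_basis) <-.
Qed.

Lemma relLI s r r' t : r + r' = s + t ->
  J s r * E r t - E s r' * J r' t = (r - s)%:~R * J s t
    + (s == t)%:R * (((r' - s) ^+ 2 - (r' - s))%:~R * zet s).
Proof.
move=> e; have e1 := hE r t; have e2 := hJ r' t.
rewrite (_ : t - r = r' - s) in e1; last lia.
rewrite (_ : t - r' = r - s) in e2; last lia.
have := act_bracket << Lgen (r' - s) >> << Igen (r - s) >> (v s).
rewrite (hJ s r) (hE s r') !lie_actZ e1 e2.
rewrite hv_bracketLI lie_act_lin2 hzet.
rewrite (_ : r' - s + (r - s) = t - s); last lia.
rewrite (hJ s t) (_ : (t - s == 0) = (s == t)); last lia.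
case: eqP => [<-|_].
  rewrite !scalerA -scalerBl -scalerDl => /(scale_basis_inj v_basis) <-.
  by ring.
by rewrite !mul0r scale0r !addr0 !scalerA -scalerBl =>
  /(scale_basis_inj v_basis) <-.
Qed.

Lemma relII s r r' t : r + r' = s + t ->
  J s r * J r t - J s r' * J r' t = (s == t)%:R * ((r - s)%:~R * eta s).
Proof.
move=> e; have e1 := hJ r t; have e2 := hJ r' t.
rewrite (_ : t - r = r' - s) in e1; last lia.
rewrite (_ : t - r' = r - s) in e2; last lia.
have := act_bracket << Igen (r' - s) >> << Igen (r - s) >> (v s).
rewrite (hJ s r) (hJ s r') !lie_actZ e1 e2.
rewrite hv_bracketII lie_actZl heta.
rewrite (_ : r' - s + (r - s) = t - s); last lia.
rewrite (_ : (t - s == 0) = (s == t)); last lia.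
case: eqP => [<-|_].
  rewrite !scalerA -scalerBl => /(scale_basis_inj v_basis) <-.
  by ring.
rewrite mulr0 scale0r mul0r !scalerA -scalerBl -(scale0r (v t)).
by move=> /(scale_basis_inj v_basis) <-.
Qed.

Lemma central_invariant (z : heisvir F) (phi : int -> F) : hv_central z ->
  (forall s, rho z (v s) = phi s *: v s) ->
  (forall s t, E s t != 0 -> phi s = phi t)
  /\ (forall s t, J s t != 0 -> phi s = phi t).
Proof.
move=> cz hz.
have H x s t k : rho x (v s) = k *: v t -> k != 0 -> phi s = phi t.
  move=> e k0; have := act_bracket x z (v s).
  rewrite cz hz e !lie_actZ hz e.
  have -> : rho 0 (v s) = 0 *: v t.
    by have := lie_act_lin2 0 0 0 0 (v s); rewrite !scale0r !addr0.
  rewrite !scalerA -scalerBl => /(scale_basis_inj v_basis) /esym e0.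
  by apply: (mulfI k0); apply: (lincomb1 (k1 := 1) e0); ring.
by split=> s t; apply: H; [apply: hE | apply: hJ].
Qed.

(** The projection [P] onto the span of the v_t with [phi t = phi s0] commutes with the action, so
    its image and kernel are complementary submodules. The image contains [v s0], hence the kernel
    is zero. *)
Lemma edge_invariant_const (T : eqType) (phi : int -> T) : indecomposable rho ->
  (forall s t, E s t != 0 -> phi s = phi t) ->
  (forall s t, J s t != 0 -> phi s = phi t) ->
  forall s t, phi s = phi t.
Proof.
move=> [_ indec] phiE phiJ s0 t0.
pose P u := lin_ext (fun t => if phi t == phi s0 then v t else 0)
  (basis_coord v_basis u).
have P_lin : linear P by move=> k x y;
  rewrite /P basis_coord_linear lin_ext_linear.
have P_basis t : P (v t) = if phi t == phi s0 then v t else 0.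
  by rewrite /P coord_basis lin_extU.
have P0 : P 0 = 0 by rewrite /P linear0 linear0.
have PZ k u : P (k *: u) = k *: P u.
  by rewrite -[k *: u]addr0 P_lin P0 addr0.
have gen g s : exists k t, rho << g >> (v s) = k *: v t /\
  (k != 0 -> phi s = phi t).
  case: g => [m|m|||].
  - exists (E s (m + s)), (m + s); split; last exact: phiE.
    by rewrite -hE addrK.
  - exists (J s (m + s)), (m + s); split; last exact: phiJ.
    by rewrite -hJ addrK.
  - by exists (kap s), s.
  - by exists (eta s), s.
  by exists (zet s), s.
have r0 x : rho x 0 = 0 by rewrite -[0 in LHS](scale0r 0) lie_actZ scale0r.
have PP u : P (P u) = P u.
  move: u; apply: (basis_linear_eq v_basis) => //.
    by move=> k x y; rewrite !P_lin.
  by move=> t; rewrite P_basis; case: ifP => h; rewrite ?P0 // P_basis h.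
have comm x u : P (rho x u) = rho x (P u).
  move: u; apply: (basis_linear_eq v_basis).
  - by move=> k y z; rewrite lie_act_linearr P_lin.
  - by move=> k y z; rewrite P_lin lie_act_linearr.
  move=> s; move: x.
  apply: (malg_linear_eq (f := fun x => P (rho x (v s)))
    (g := fun x => rho x (P (v s)))).
  - by move=> k y z; rewrite lie_act_linearl P_lin.
  - by move=> k y z; rewrite lie_act_linearl.
  move=> g; have [k [t [e hk]]] := gen g s.
  rewrite e PZ !P_basis; have [k0|/hk <-] := eqVneq k 0.
    by case: (phi s == phi s0); rewrite ?r0 ?e k0 !scale0r.
  by case: (phi s == phi s0); rewrite ?r0 ?scaler0 ?e.
case: (indec (fun u => P u = u) (fun u => P u = 0)).
- split=> [|k u w hu hw|x u hu]; first exact: P0.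
    by rewrite P_lin hu hw.
  by rewrite comm hu.
- split=> [|k u w hu hw|x u hu]; first exact: P0.
    by rewrite P_lin hu hw scaler0 addr0.
  by rewrite comm hu r0.
- move=> u; exists (P u), (u - P u); split;
  [exact: PP | | by rewrite addrC subrK].
  by rewrite -scaleN1r addrC P_lin PP scaleN1r addNr.
- by move=> u -> .
- move/(_ (v s0)); rewrite P_basis eqxx => /(_ erefl) e.
  by have := basis_neq0 v_basis s0; rewrite e eqxx.
move/(_ (v t0)); rewrite P_basis; case: eqP => [->//|_ /(_ erefl) e].
by have := basis_neq0 v_basis t0; rewrite e eqxx.
Qed.

(** The scalars to be shown constant agree at both ends of a nonzero edge: the central ones by
    commutation, [E s s - s] and [J s s] by brackets with L(0) and I(0). *)
Lemma module_classified : indecomposable rho ->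
  [/\ forall s, kap s = 0, forall s, eta s = 0, forall s, zet s = 0
    & hv_classified E J].
Proof.
move=> indec.
have conn (T : eqType) (phi : int -> T) :
    (forall s t, E s t != 0 -> phi s = phi t) /\
    (forall s t, J s t != 0 -> phi s = phi t) -> forall s, phi s = phi 0.
  by case=> hE' hJ' s; apply: edge_invariant_const indec hE' hJ' s 0.
have kapE := conn _ _ (central_invariant (@hv_centralP F CLgen I) hkap).
have etaE := conn _ _ (central_invariant (@hv_centralP F CIgen I) heta).
have zetE := conn _ _ (central_invariant (@hv_centralP F CLIgen I) hzet).
have wtE : forall s, E s s - s%:~R = E 0 0 - 0%:~R.
  apply: conn; split=> s t n0; apply: (mulfI n0).
    have := @relLL s t s t (addrC _ _); rewrite subrr expr0n /= subrr mulr0z.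
    rewrite !(mul0r, mulr0) addr0 => e.
    by apply: (lincomb1 (k1 := -1) e); ring.
  have := @relLI s t s t (addrC _ _); rewrite subrr expr0n /= subrr mulr0z.
  rewrite !(mul0r, mulr0) addr0 => e.
  by apply: (lincomb1 (k1 := -1) e); ring.
have JE : forall s, J s s = J 0 0.
  apply: conn; split=> s t n0; apply: (mulfI n0).
    have := @relLI s s t t erefl; rewrite subrr mulr0z mul0r add0r.
    have [<-|_] := eqVneq s t; first by rewrite mulrC.
    rewrite mul0r => e.
    by apply: (lincomb1 (k1 := 1) e); ring.
  have := @relII s s t t erefl; rewrite subrr mulr0z mul0r mulr0 => e.
  by apply: (lincomb1 (k1 := 1) e); ring.
pose a := E 0 0.
have diff r s : (r - s)%:~R = wt a r - wt a s :> F by rewrite /wt; ring.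
have hV : vir_rel a (kap 0) E.
  split=> [t|s r r' t e].
    by apply: (lincomb1 (k1 := 1) (wtE t)); rewrite /wt /a; ring.
  rewrite relLL // diff kapE; congr (_ + _ * _).
  by rewrite -diff; congr (_ * _ * _); ring.
have hH : heis_rel a (zet 0) (eta 0) (J 0 0) E J.
  split=> [t|s r r' t e|s r r' t e]; first exact: JE.
    rewrite relLI // diff zetE -(diff t r) (_ : t - r = r' - s); last lia.
    by congr (_ + _ * (_ * _)); ring.
  by rewrite relII // diff etaE.
have [|k0 z0 e0 cl] := hv_classification hV hH.
  move=> o split_o.
  (* The indicator of an isolated vertex is constant along nonzero edges, hence would be
     constant. *)
  have phi_o : forall s, (s == o) = (0 == o).
    apply: conn; split=> s t; have [->|so] := eqVneq s o;
      have [->|to_] := eqVneq t o => //; apply: contraNeq => _.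
    - by have [->] := split_o t to_.
    - by have [_ ->] := split_o s so.
    - by have [_ _ ->] := split_o t to_.
    by have [_ _ _ ->] := split_o s so.
  have := phi_o o; have := phi_o (o + 1); rewrite eqxx => <-; lia.
by split=> // s; rewrite ?kapE ?etaE ?zetE.
Qed.

Lemma module_iso lc ic (rel : series_rel lc ic) :
  (forall s, kap s = 0) -> (forall s, eta s = 0) -> (forall s, zet s = 0) ->
  hv_model lc ic E J -> lie_module_iso rho (series_module rel).
Proof.
move=> k0 e0 z0 [c [sh [c0 h]]].
(* The inverse appears because [gauge c] is the matrix in the basis [c t *: v t], and it is this
   basis that is sent to the basis of the model. *)
pose f u : {malg F[int]} :=
  lin_ext (fun t => (c t)^-1 *: << t + sh >>) (basis_coord v_basis u).
pose g := lin_ext (fun t => c (t - sh) *: v (t - sh)).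
have f_lin : linear f by move=> k x y;
  rewrite /f basis_coord_linear lin_ext_linear.
have f_basis t : f (v t) = (c t)^-1 *: << t + sh >>.
  by rewrite /f coord_basis lin_extU.
pose f' : {linear V -> {malg F[int]}} :=
  HB.pack f (GRing.isLinear.Build F V {malg F[int]} *:%R f f_lin).
have f'E u : f' u = f u by [].
exists f'; split.
  exists g => [u|x].
    move: u; apply: (basis_linear_eq v_basis) => [k x y|k x y|t] //.
      by rewrite linearP /g lin_ext_linear.
    rewrite f'E f_basis /g linearZ /= lin_extU addrK scalerA mulVf ?scale1r //.
  move: x; apply: malg_linear_eq => [k x y|k x y|t] //.
    by rewrite /g lin_ext_linear linearP.
  by rewrite /g lin_extU linearZ /= f_basis subrK scalerA divff ?scale1r.
move=> x u; rewrite !f'E; move: u; apply: (basis_linear_eq v_basis).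
- by move=> k y z; rewrite lie_act_linearr f_lin.
- by move=> k y z; rewrite f_lin lie_act_linearr.
move=> s; move: x.
apply: (malg_linear_eq (f := fun x => f (rho x (v s)))
  (g := fun x => series_module rel x (f (v s)))).
- by move=> k y z; rewrite lie_act_linearl f_lin.
- by move=> k y z; rewrite lie_act_linearl.
have f0 : f 0 = 0 by rewrite /f linear0 linear0.
have fZ k w : f (k *: w) = k *: f w.
  by rewrite -[k *: w]addr0 f_lin f0 addr0.
have act G : series_module rel << G >> (f (v s))
    = (c s)^-1 *: series_gen_act lc ic G (s + sh).
  by rewrite f_basis /= series_actZ series_actU.
have coef (A : F) r t al : gauge c (fun _ _ => A) r t = al ->
    A *: f (v t) = (c r)^-1 *: (al *: << t + sh >>).
  by move=> <-; rewrite f_basis !scalerA /gauge; congr (_ *: _); field;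
    rewrite !c0.
case=> [m|m|||]; rewrite act /=.
- have := hE s (m + s); rewrite addrK => ->; rewrite fZ.
  have [e _] := h s (m + s); rewrite addrK in e.
  by rewrite (coef _ _ _ _ e) addrA.
- have := hJ s (m + s); rewrite addrK => ->; rewrite fZ.
  have [_ e] := h s (m + s); rewrite addrK in e.
  by rewrite (coef _ _ _ _ e) addrA.
- by rewrite hkap k0 fZ scale0r scaler0.
- by rewrite heta e0 fZ scale0r scaler0.
by rewrite hzet z0 fZ scale0r scaler0.
Qed.

End Coefficients.

Theorem theorem3p5 (R : realType) (V : lmodType R[i])
    (rho : lie_module (heisvir R[i]) V) (v : int -> V)
    (v_basis : is_basis v)
    (v_graded : forall (m n : int) (x : heisvir R[i]), hv_homog m x ->
       exists k : R[i], rho x (v n) = k *: v (m + n))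
    (rho_indec : indecomposable rho) :
  (exists a b c : R[i], lie_module_iso rho (mod_Aabc a b c)) \/
  (exists a d : R[i], lie_module_iso rho (mod_Aad a d)) \/
  (exists a d : R[i], lie_module_iso rho (mod_Bad a d)) \/
  (exists d : R[i], lie_module_iso rho (mod_U d)) \/
  (exists d : R[i], lie_module_iso rho (mod_V d)) \/
  (exists d : R[i], d != 0 /\ lie_module_iso rho (mod_Utilde d)) \/
  (exists c : R[i], c != 0 /\ lie_module_iso rho (mod_Vtilde c)).
Proof.
have [E [J [kap [eta [zet [hE hJ hk he hz]]]]]] := coefficients_exist v_graded.
have [k0 e0 z0 cl] := module_classified v_basis hE hJ hk he hz rho_indec.
have iso lc ic rel := @module_iso _ _ _ _ v_basis _ _ _ _ _ hE hJ hk he hz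
  lc ic rel k0 e0 z0.
case: cl => [[a [b [c m]]]|cl].
  by left; exists a, b, c; apply: iso.
right; case: cl => [[a [d m]]|cl]; first by left; exists a, d; apply: iso.
right; case: cl => [[a [d m]]|cl]; first by left; exists a, d; apply: iso.
right; case: cl => [[d m]|cl]; first by left; exists d; apply: iso.
right; case: cl => [[d m]|cl]; first by left; exists d; apply: iso.
right; case: cl => [[d [d0 m]]|[c [c0 m]]].
  by left; exists d; split=> //; apply: iso.
by right; exists c; split=> //; apply: iso.
Qed.
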